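(* Let $\mathcal{H}$ be an essential non-central hyperplane arrangement in $\mathbb{R}^n$ with unbounded intersection lattice $\mathcal{L}_{ub}$ and poset of unbounded regions $T_{ub}$. Then $$\Psi(T_{ub})=\omega\bigl(\mathbf a\cdot\Psi(\mathcal{L}_{ub})\bigr)^*.$$
   Context: Essential: the normals of the hyperplanes span $\mathbb{R}^n$; non-central: the intersection of all hyperplanes is empty. The intersection lattice $\mathcal{L}$ consists of all nonempty intersections of subsets of the hyperplanes (empty intersection $=\mathbb{R}^n$) plus $\emptyset$ as maximum, ordered by reverse inclusion. $\mathcal{L}_{ub}$ is $\mathcal{L}$ with all $0$-dimensional elements (points) removed, ranked by $\rho(x)=n-\dim x$ for nonempty $x$ and $\rho(\emptyset)=n$. The faces of $\mathcal{H}$ are the nonempty relatively open cells of the induced decomposition of $\mathbb{R}^n$. $T_{ub}$ consists of the unbounded faces together with a minimum $\hat0$ (rank 0) and maximum $\hat1$ (rank $n+1$), ordered by $F\le G$ iff $F\subseteq\bar G$, an unbounded face of dimension $i$ having rank $i$ (it is the face poset of the $(n-1)$-sphere complex obtained by intersecting $\mathcal{H}$ with a large sphere). For a poset $P$ with $\hat0,\hat1$ and rank function with $\rho(\hat1)=N+1$: $f_S$ ($S=\{s_1<\dots<s_{k-1}\}\subseteq\{1,\dots,N\}$) counts chains $\hat0<x_1<\dots<x_{k-1}<\hat1$ with $\rho(x_j)=s_j$, $h_S=\sum_{T\subseteq S}(-1)^{|S-T|}f_T$, $\Psi(P)=\sum_Sh_Su_S\in\mathbb{Z}\langle\mathbf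 a,\mathbf b\rangle$ with $u_S=u_1\cdots u_N$, $u_i=\mathbf b$ if $i\in S$ else $\mathbf a$. $\mathbf c=\mathbf a+\mathbf b$, $\mathbf d=\mathbf{ab}+\mathbf{ba}$; $\omega$ is the linear map replacing each occurrence of $\mathbf{ab}$ in a monomial by $2\mathbf d$ and then each remaining letter by $\mathbf c$; $^*$ reverses each monomial, extended linearly. *)

(* Defs.v *)
From HB Require Import structures.
From mathcomp Require Import all_boot all_order all_algebra finmap.
From mathcomp Require Import monalg.
From mathcomp Require Import boolp classical_sets reals topology normedtype.

Set Implicit Arguments.
Unset Strict Implicit.
Unset Printing Implicit Defensive.

Import Order.TTheory GRing.Theory Num.Theory.
Import numFieldNormedType.Exports.

Local Open Scope classical_set_scope.
Local Open Scope ring_scope.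

(* Z<a,b> is the monoid algebra of the free monoid on two letters, with
   [false] standing for a and [true] for b. *)
Notation Zab := {malg int[{fmonom bool}]}.

Definition word (w : seq bool) : Zab := << FMonom w >>.
Definition ab_a : Zab := word [:: false].
Definition ab_b : Zab := word [:: true].
Definition ab_c : Zab := ab_a + ab_b.
Definition ab_d : Zab := ab_a * ab_b + ab_b * ab_a.

(* Linear extension of a map defined on monomials. *)
Definition word_ext (f : seq bool -> Zab) (p : Zab) : Zab :=
  \sum_(w <- msupp p) p@_w *: f w.

(* Two occurrences of ab in a word never overlap, so replacing all of them
   amounts to a left-to-right scan. *)
Fixpoint omega_word (w : seq bool) : Zab :=
  match w with
  | [::] => 1
  | false :: true :: w' => 2%:R * ab_d * omega_word w'
  | _ :: w' => ab_c * omega_word w'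
  end.

Definition omega : Zab -> Zab := word_ext omega_word.
Definition ab_rev : Zab -> Zab := word_ext (fun w => word (rev w)).

(* The data of a finite poset with minimum, maximum and rank function; its
   elements form a finite subset of the ambient type [rp_type]. *)
Record ranked_poset := RankedPoset {
  rp_type : choiceType;
  rp_elts : {fset rp_type};
  rp_le : rel rp_type;
  rp_bot : rp_type;
  rp_top : rp_type;
  rp_rank : rp_type -> nat
}.

Section AbIndex.
Variable P : ranked_poset.

Definition rp_lt : rel (rp_type P) := fun x y => (x != y) && rp_le x y.

(* The N with rank(1) = N + 1; the element i : 'I_N stands for the rank i + 1,
   so that {set 'I_N} encodes the subsets of {1, ..., N}. *)
Definition rp_N : nat := (rp_rank (rp_top P)).-1.

Definition flag_f (S : {set 'I_rp_N}) : nat :=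
  #|[pred t : #|S|.-tuple (rp_elts P) |
      path rp_lt (rp_bot P) (rcons [seq val x | x <- t] (rp_top P))
      && ([seq rp_rank (val x) | x <- t] == [seq (val i).+1 | i <- enum S])]|.

Definition flag_h (S : {set 'I_rp_N}) : int :=
  \sum_(T in powerset S) (-1) ^+ #|S :\: T| * (flag_f T)%:R.

Definition ab_monomial (S : {set 'I_rp_N}) : Zab :=
  word [seq i \in S | i <- enum 'I_rp_N].

Definition ab_index : Zab :=
  \sum_(S : {set 'I_rp_N}) flag_h S *: ab_monomial S.

End AbIndex.

Inductive with_bounds (T : Type) := Bot | Elt of T | Top.
Arguments Bot {T}.
Arguments Top {T}.

Section WithBounds.
Variable T : Type.

Definition wb_encode (x : with_bounds T) : option (option T) :=
  match x with Bot => None | Elt y => Some (Some y) | Top => Some None end.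
Definition wb_decode (x : option (option T)) : with_bounds T :=
  match x with None => Bot | Some (Some y) => Elt y | Some None => Top end.
Lemma wb_encodeK : cancel wb_encode wb_decode. Proof. by case. Qed.

Definition wb_le (le : rel T) : rel (with_bounds T) := fun x y =>
  match x, y with
  | Bot, _ | _, Top => true
  | Elt x', Elt y' => le x' y'
  | _, _ => false
  end.

End WithBounds.

HB.instance Definition _ (T : eqType) :=
  Equality.copy (with_bounds T) (can_type (@wb_encodeK T)).
HB.instance Definition _ (T : choiceType) :=
  Choice.copy (with_bounds T) (can_type (@wb_encodeK T)).

Record hyperplane (R : realType) (n : nat) := Hyperplane {
  hp_normal : 'rV[R]_n;
  hp_offset : R;
  hp_normal_neq0 : hp_normal != 0
}.

Section Arrangement.
Variables (R : realType) (n : nat).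

Definition hp_form (h : hyperplane R n) (x : 'rV[R]_n) : R :=
  (\sum_(j < n) hp_normal h ord0 j * x ord0 j) - hp_offset h.

Definition hp_set (h : hyperplane R n) : set 'rV[R]_n :=
  [set x | hp_form h x = 0].

(* Dimension of the affine hull of a nonempty set A: the largest k such that
   A contains k + 1 affinely independent points x, x + M_1, ..., x + M_k. *)
Definition affdim (A : set 'rV[R]_n) : nat :=
  \max_(k < n.+1 | `[< exists (x : 'rV[R]_n) (M : 'M[R]_(k, n)),
       [/\ row_free M, A x & forall i, A (x + row i M)] >]) k.

Variables (m : nat) (H : 'I_m -> hyperplane R n).

Definition essential : Prop := row_full (\matrix_(i < m) hp_normal (H i)).

Definition noncentral : Prop := \bigcap_i hp_set (H i) = set0.

Definition flat (S : {set 'I_m}) : set 'rV[R]_n :=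
  \bigcap_(i in [set i | i \in S]) hp_set (H i).

Definition lattice_elts : {fset set 'rV[R]_n} :=
  (set0 |` [fset flat S | S in {set 'I_m} & flat S != set0])%fset.

Definition lattice_ub_elts : {fset set 'rV[R]_n} :=
  [fset X in lattice_elts | (X == set0) || (affdim X != 0)]%fset.

Definition lattice_ub : ranked_poset :=
  RankedPoset lattice_ub_elts (fun X Y => `[< Y `<=` X >]) setT set0
    (fun X => if X == set0 then n else n - affdim X)%N.

(* The points lying strictly on the positive side of the hyperplanes in S.1,
   strictly on the negative side of those in S.2, and on all the others. *)
Definition cell (S : {set 'I_m} * {set 'I_m}) : set 'rV[R]_n :=
  [set x | forall i, (0 < hp_form (H i) x) = (i \in S.1) /\
                     (hp_form (H i) x < 0) = (i \in S.2)].

Definition faces : {fset set 'rV[R]_n} :=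
  [fset cell S | S in {: {set 'I_m} * {set 'I_m}} & cell S != set0]%fset.

Definition unbounded_faces : {fset set 'rV[R]_n} :=
  [fset F in faces | ~~ `[< bounded_set F >]]%fset.

Definition face_rank (F : with_bounds (set 'rV[R]_n)) : nat :=
  match F with Bot => 0 | Elt F' => affdim F' | Top => n.+1 end.

Definition T_ub : ranked_poset :=
  RankedPoset (Bot |` (Top |` [fset Elt F | F in unbounded_faces]))%fset
    (wb_le (fun F G : set 'rV[R]_n => `[< F `<=` closure G >])) Bot Top
    face_rank.

End Arrangement.

(* Main.v *)
(* Write e = a - b.  The ab-index of a ranked poset is the sum over its chains of
   the words with b at the occupied ranks and e at the others.  Sending an
   unbounded face to its affine span maps T_ub to the order dual of L_ub, and the
   numbers N(x, y) of faces spanning x above a given face spanning y (and N(x, 1)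
   of unbounded faces spanning x) only depend on x and y: both are determined by
   the Euler relations
     sum_(x <= z <= y) (-1)^(rank z - rank x) N(z, y) = 1.
   Unfolding the resulting recursion inside the chain sums of T_ub, read from the
   top down, gives the recursion that omega induces on the chain sums of L_ub,
   because omega(e^m b w) is e^m c omega(w) for m even and - e^(m+1) omega(w) for
   m odd.

   The Euler relations are proved by cutting along one hyperplane at a time: a
   relatively open convex cell is either untouched or split into two cells of the
   same dimension and one of dimension one less, so the alternating sum of the
   dimensions does not change.  The same holds for the bounded cells only, as soon
   as the forms defining a cell control its points: the sum of the absolute values
   of these forms is an affine function on the cell which detects boundedness.
   Hence the alternating number of bounded cells of a flat is the same for the
   arrangement and for the coordinate hyperplanes through a point of the flat,
   where that point is the only bounded cell. *)

From HB Require Import structures.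
Require Import Defs.
From mathcomp Require Import all_boot all_order all_algebra finmap.
From mathcomp Require Import monalg zify ring lra.
From mathcomp Require Import boolp classical_sets reals topology normedtype.

Set Implicit Arguments.
Unset Strict Implicit.
Unset Printing Implicit Defensive.

Import Order.TTheory GRing.Theory Num.Theory.
Import numFieldNormedType.Exports.

Local Open Scope ring_scope.

(** * The operator omega *)

Lemma scale_intE (V : lmodType int) (c : int) (v : V) : c *: v = v *~ c.
Proof. by rewrite -scaler_int intz. Qed.

Lemma word_cat u v : word (u ++ v) = word u * word v.
Proof. by rewrite /word malgM_def fgmulUU mulr1 [mmul _ _]fmmulE. Qed.

Lemma word_nil : word [::] = 1.
Proof. by rewrite /word -fmoneE. Qed.

Lemma word_cons x w : word (x :: w) = word [:: x] * word w.
Proof. exact: (word_cat [:: x]). Qed.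

Section WordExt.
Variable f : seq bool -> Zab.

Lemma word_extEw (d : {fset {fmonom bool}}) p : (msupp p `<=` d)%fset ->
  word_ext f p = \sum_(w <- d) p@_w *: f w.
Proof.
move=> le; rewrite /word_ext (big_fset_incl _ le) // => w _ /mcoeff_outdom ->.
by rewrite scale0r.
Qed.

Fact word_ext_is_zmod_morphism : zmod_morphism (word_ext f).
Proof.
move=> p q; set d := (msupp p `|` msupp q)%fset.
rewrite (@word_extEw d p) ?fsubsetUl // (@word_extEw d q) ?fsubsetUr //.
rewrite (@word_extEw d (p - q)) ?msuppB_le // -sumrB.
by apply: eq_bigr => w _; rewrite mcoeffB scalerBl.
Qed.

HB.instance Definition _ :=
  GRing.isZmodMorphism.Build Zab Zab (word_ext f) word_ext_is_zmod_morphism.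

Lemma word_ext_word w : word_ext f (word w) = f w.
Proof. by rewrite /word_ext /word msuppU1 big_seq_fset1 mcoeffU1 eqxx scale1r. Qed.

End WordExt.

HB.instance Definition _ := GRing.Additive.copy omega (word_ext omega_word).
HB.instance Definition _ :=
  GRing.Additive.copy ab_rev (word_ext (fun w => word (rev w))).

(** Words generate Z<a,b> as an abelian group, and closure under differences yields 0, opposites and
    sums. *)
Lemma Zab_ind (P : Zab -> Prop) :
    (forall w, P (word w)) -> (forall p q, P p -> P q -> P (p - q)) ->
  forall p, P p.
Proof.
move=> Pw PB p; have P0 : P 0 by rewrite -(subrr (word [::])); apply: PB.
have PN q : P q -> P (- q) by move=> Pq; rewrite -sub0r; apply: PB.
have PD q r : P q -> P r -> P (q + r) by rewrite -{2}[r]opprK => ? ?; apply/PB/PN.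
have PMn q k : P q -> P (q *+ k).
  by move=> Pq; elim: k => [|k IH]; rewrite ?mulr0n // mulrS; apply: PD.
rewrite (monalgE p); elim/big_ind: _ => // w _; case: w => w.
have -> : << p@_(FMonom w) *g FMonom w >> = word w *~ p@_(FMonom w).
  by apply/malgP => k; rewrite raddfMz /= !mcoeffU -mulrzl mulr_natr intz.
by case: (p@_ _) => k; [exact: PMn|apply/PN/PMn].
Qed.

Section AdditiveExt.
Variables (A : nzRingType) (T : Type) (G : T -> A) (w : A -> A).
Hypothesis wB : forall p q, w (p - q) = w p - w q.
Hypothesis G_ind : forall P : A -> Prop,
  (forall t, P (G t)) -> (forall p q, P p -> P q -> P (p - q)) -> forall p, P p.

Lemma additive_mull_ext x y z :
  (forall t, w (x * G t) = y * w (z * G t)) -> forall p, w (x * p) = y * w (z * p).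
Proof.
by move=> wG; apply: G_ind => // p q; rewrite !mulrBr !wB mulrBr => -> ->.
Qed.

End AdditiveExt.

Lemma omega_wordE w : omega (word w) = omega_word w.
Proof. exact: word_ext_word. Qed.

(** Besides additivity, this value and the next four rules are all that the chain computation uses
    of [omega]. *)
Lemma omega1 : omega 1 = 1.
Proof. by rewrite -word_nil omega_wordE word_nil. Qed.

Lemma omega_a : omega ab_a = ab_c.
Proof. by rewrite /ab_a omega_wordE /= mulr1. Qed.

Lemma omega_bM p : omega (ab_b * p) = ab_c * omega p.
Proof.
rewrite -[in RHS](mul1r p); apply: (additive_mull_ext (G := word)) p => [||w].
- exact: raddfB.
- exact: Zab_ind.
rewrite mul1r omega_wordE; exact: (etrans (congr1 omega (esym (word_cons _ _))) (omega_wordE (true :: w))).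
Qed.

Lemma omega_aaM p : omega (ab_a * (ab_a * p)) = ab_c * omega (ab_a * p).
Proof.
rewrite mulrA; apply: (additive_mull_ext (G := word)) p => [||w].
- exact: raddfB.
- exact: Zab_ind.
have -> : ab_a * word w = word (false :: w) by rewrite [RHS]word_cons.
have -> : ab_a * ab_a * word w = word [:: false, false & w].
  by rewrite -mulrA [RHS]word_cons (word_cons false w).
by rewrite !omega_wordE.
Qed.

Lemma omega_abM p : omega (ab_a * (ab_b * p)) = ab_d *+ 2 * omega p.
Proof.
rewrite mulrA -[in RHS](mul1r p).
apply: (additive_mull_ext (G := word)) p => [||w].
- exact: raddfB.
- exact: Zab_ind.
have -> : ab_a * ab_b * word w = word [:: false, true & w].
  by rewrite -mulrA [RHS]word_cons (word_cons true w).
rewrite mul1r !omega_wordE; exact: (congr1 (fun q => q * omega_word w) (mulr_natl ab_d 2)).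
Qed.

Lemma sqrrD_noncomm (A : nzRingType) (a b : A) :
  (a + b) ^+ 2 = a * a + b * b + (a * b + b * a).
Proof. by rewrite expr2 mulrDl !mulrDr [b * a + _]addrC addrACA. Qed.

(** For the letters a and b this is e^2 = c^2 - 2d, which turns the 2d produced by omega into a
    power of e. *)
Lemma sqrrB_noncomm (A : nzRingType) (a b : A) :
  (a - b) ^+ 2 = (a + b) ^+ 2 - (a * b + b * a) *+ 2.
Proof.
by rewrite !sqrrD_noncomm mulrNN mulrN mulNr -opprD mulr2n [in RHS]opprD [RHS]addrA addrK.
Qed.

Definition ab_e : Zab := ab_a - ab_b.

(** * The recursion for the cell counts and the operator omega *)

(** The sign of a term moved to the other side of an Euler relation. *)
Definition eps (k : nat) : int := - (-1) ^+ k.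

Lemma eps1E k : 1 + eps k = if odd k then 2 else 0.
Proof. by rewrite /eps -signr_odd; case: odd. Qed.

Lemma epsE k : eps k = if odd k then 1 else -1.
Proof. by rewrite /eps -signr_odd; case: odd. Qed.

Section Abstract.
(* [w] stands for omega, [N0 x] for the number of unbounded faces spanning x,
   [N x y] for the number of faces spanning x above a given face spanning y,
   [psi x] for the ab-index of the interval from x to the maximum, and [g x] for
   the sum over the chains of faces whose largest face spans x. *)
Variables (A : nzRingType) (a b : A) (w : {additive A -> A}).
Let c := a + b.
Let e := a - b.
Hypothesis w1 : w 1 = 1.
Hypothesis w_a : w a = c.
Hypothesis w_bM : forall p, w (b * p) = c * w p.
Hypothesis w_aaM : forall p, w (a * (a * p)) = c * w (a * p).
Hypothesis w_abM : forall p, w (a * (b * p)) = (a * b + b * a) *+ 2 * w p.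

Let c_eb : c = e + b *+ 2.
Proof. by rewrite /c /e mulr2n addrA subrK. Qed.

Lemma w_aM p : w (a * p) = w (e * p) + c * w p.
Proof. by rewrite mulrBl raddfB w_bM subrK. Qed.

Let w_eM p : w (e * p) = w (a * p) - c * w p.
Proof. by rewrite w_aM addrK. Qed.

(** Here w(ebp) = (2d - c^2) w(p), and c^2 - 2d = e^2. *)
Let w_ebM p : w (e * (b * p)) = - (e * (e * w p)).
Proof.
rewrite w_eM w_abM w_bM !mulrA -mulrBl -[RHS]mulNr; congr (_ * _).
by rewrite -[e * e]expr2 sqrrB_noncomm opprB expr2.
Qed.

Let w_eeM p : w (e * (e * p)) = e * (e * w p).
Proof.
have -> : e * p = a * p - b * p by rewrite mulrBl.
by rewrite mulrBr raddfB w_ebM opprK w_eM w_aaM subrr add0r.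
Qed.

Let w_e : w e = 0.
Proof. by rewrite -[e]mulr1 w_eM w1 !mulr1 w_a subrr. Qed.

(** Pairs of leading letters e pass through w, so only the parity of m matters. *)
Lemma w_eXM m p : w (e ^+ m * p) =
  if odd m then e ^+ m.-1 * w (e * p) else e ^+ m * w p.
Proof.
elim/ltn_ind: m => -[|[|m]] IH; rewrite ?expr0 ?expr1 ?mul1r //.
rewrite [e ^+ m.+2]exprS [e ^+ m.+1]exprS -!mulrA w_eeM (IH m (leqnSn _)) /= negbK.
case: ifP => //; case: m {IH} => // m _.
by rewrite /= [e ^+ m.+1]exprS !mulrA.
Qed.

Lemma w_eX m : w (e ^+ m) = if odd m then 0 else e ^+ m.
Proof. by rewrite -[e ^+ m in LHS]mulr1 w_eXM mulr1 w_e w1 mulr1 mulr0. Qed.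

Lemma w_eXbM m p : w (e ^+ m * (b * p)) =
  if odd m then - (e ^+ m.+1 * w p) else e ^+ m * (c * w p).
Proof.
rewrite w_eXM w_ebM w_bM; case: ifP => //.
by case: m => // m _; rewrite mulrN [e ^+ m.+2]exprSr [e ^+ m.+1]exprSr !mulrA.
Qed.

Variables (I : finType) (d : I -> nat) (lt : rel I).
Hypothesis d_gt0 : forall x, (0 < d x)%N.
Hypothesis lt_trans : transitive lt.
Hypothesis lt_d : forall x y, lt x y -> (d y < d x)%N.

Variables (N0 : I -> int) (N : I -> I -> int).
Hypothesis N_rec : forall x y, lt x y ->
  N x y = 1 + eps (d x + d y) +
          \sum_(z | lt x z && lt z y) eps (d x + d z) * N z y.
Hypothesis N0_rec : forall x,
  N0 x = 1 + eps (d x) + \sum_(z | lt x z) eps (d x + d z) * N0 z.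

Variables psi g : I -> A.
Hypothesis psi_rec : forall x, psi x =
  e ^+ (d x).-1 + \sum_(y | lt x y) e ^+ (d x - d y).-1 * (b * psi y).
Hypothesis g_rec : forall x, g x =
  e ^+ (d x).-1 *~ N0 x +
  \sum_(y | lt x y) (e ^+ (d x - d y).-1 * (b * g y)) *~ N x y.

(** The counts disappear: once [N0] and [N] are expanded by their recursions, the terms through an
    intermediate z regroup, by [g_rec] read backwards, into [g z]. *)
Lemma g_rec_eps x : g x =
  e ^+ (d x).-1 *~ (1 + eps (d x)) +
  \sum_(y | lt x y) (e ^+ (d x - d y).-1 * (b * g y) *~ (1 + eps (d x + d y))
                     + e ^+ (d x - d y) * g y *~ eps (d x + d y)).
Proof.
rewrite g_rec N0_rec mulrzDr -addrA; congr (_ + _).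
rewrite (eq_bigr _ (fun y xy => congr1 (fun k => _ *~ k) (N_rec xy))).
under eq_bigr do rewrite mulrzDr.
rewrite !big_split /= addrCA; congr (_ + _).
transitivity (\sum_(z | lt x z)
   (e ^+ (d x - d z) * (e ^+ (d z).-1 *~ N0 z) *~ eps (d x + d z) +
    \sum_(y | lt z y) e ^+ (d x - d z) * (e ^+ (d z - d y).-1 * (b * g y) *~ N z y)
     *~ eps (d x + d z))).
  rewrite big_split /=; congr (_ + _).
    rewrite raddf_sum; apply: eq_bigr => z xz /=.
    rewrite mulrzAr -exprD -mulrzA mulrC; congr (_ ^+ _ *~ _).
    by have := lt_d xz; have := d_gt0 z; lia.
  rewrite (exchange_big_dep (fun y => lt x y)) /=; last first.
    by move=> z y; apply: lt_trans.
  apply: eq_bigr => y xy; rewrite raddf_sum; apply: eq_bigr => z /andP[xz zy] /=.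
  rewrite [in RHS]mulrzAr (mulrA (e ^+ (d x - d z))) -exprD -mulrzA mulrC; congr (_ ^+ _ * _ *~ _).
  by move: (lt_d xz) (lt_d zy); lia.
apply: eq_bigr => z xz; rewrite [g z in RHS]g_rec mulrDr mulrzDl mulr_sumr.
by rewrite -mulrz_suml.
Qed.

(** Induction on [d x], comparing the terms of each y. If d x - d y is odd, 2b + e = c matches the
    even case of [w_eXbM]; if it is even, only a power of e survives on both sides. *)
Lemma g_omega x : g x = w (psi x) *+ 2.
Proof.
have [k] := ubnP (d x); elim: k x => // k IH x xk.
rewrite g_rec_eps psi_rec (raddfD w) (raddf_sum w) mulrnDl -sumrMnl /=; congr (_ + _).
  rewrite eps1E w_eX; case: (d x) (d_gt0 x) => //= m _.
  by case: odd => //=; rewrite ?mul0rn ?mulr0z.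
apply: eq_bigr => y xy; have ltd := lt_d xy.
rewrite IH; last by apply: leq_trans ltd _.
rewrite eps1E epsE w_eXbM oddD -(oddB (ltnW ltd)).
have: (0 < d x - d y)%N by rewrite subn_gt0.
case: (d x - d y)%N => //= m _; case: odd => /=.
  by rewrite mulr0z add0r mulrN1z mulrnAr mulNrn.
rewrite [LHS]addrC mulr1z c_eb mulrDl mulrDr mulrnDl; congr (_ + _).
  by rewrite exprSr -mulrA !mulrnAr.
by rewrite mulrnAl !mulrnAr.
Qed.

(** The left side is the chain sum of all faces, sorted by the flat that the largest face of the
    chain spans. *)
Lemma sum_eX_g n (x0 : I) : d x0 = n -> (forall x, x != x0 -> lt x0 x) ->
  e ^+ n + \sum_x e ^+ (n - d x) * (b * g x) = w (a * psi x0).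
Proof.
move=> dx0 lt0; have n_gt0 : (0 < n)%N by rewrite -dx0.
have lt0E x : (x != x0) = lt x0 x.
  apply/idP/idP => [/lt0 //|/lt_d]; apply: contraTneq => ->; by rewrite ltnn.
rewrite w_aM (bigD1 x0) //= dx0 subnn expr0 mul1r g_omega addrCA addrC.
rewrite [b * _]mulrnAr -mulrnAl.
have -> : b *+ 2 = c - e by rewrite c_eb addrC addKr.
(* The term of x0 supplies c w(psi x0); what remains must add up to w(e psi x0). *)
rewrite mulrBl addrA addrC addrA; congr (_ + _).
rewrite (eq_bigl _ _ lt0E) psi_rec mulrDr !(raddfD w) mulr_sumr !(raddf_sum w) mulrDr.
rewrite opprD mulr_sumr addrACA -sumrN -big_split /= dx0; congr (_ + _).
  rewrite -exprS prednK // !w_eX; case: n n_gt0 {dx0} => // m _ /=.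
  by case: odd; rewrite /= ?mulr0 ?oppr0 ?add0r // -exprS addNr.
apply: eq_bigr => y xy; have ltd := lt_d xy; rewrite g_omega [e * (_ * _)]mulrA -exprS.
rewrite -dx0 prednK ?subn_gt0 // !w_eXbM.
have: (0 < d x0 - d y)%N by rewrite subn_gt0.
case: (d x0 - d y)%N => //= m _.
have -> : b * (w (psi y) *+ 2) = (c - e) * w (psi y).
  by rewrite mulrnAr -mulrnAl c_eb [e + _]addrC addrK.
rewrite (mulrBl (w _) c e) (mulrBr (e ^+ _)) (mulrA (e ^+ m.+1) e) -exprSr; case: odd => /=.
  by rewrite mulrN opprK (mulrA e) -exprS addrC subrK.
by rewrite (mulrA e) -exprS addKr.
Qed.

End Abstract.

(** * From flag vectors to chain recursions *)

Lemma prodr_mulrz (A : nzRingType) (I : Type) (r : seq I) (G : I -> A) (s : I -> int) :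
  \prod_(i <- r) (G i *~ s i) = (\prod_(i <- r) G i) *~ \prod_(i <- r) s i.
Proof.
elim: r => [|i r IH]; first by rewrite !big_nil mulr1z.
by rewrite !big_cons IH mulrzAl mulrzAr -mulrzA [_ * s i]mulrC.
Qed.

Lemma index_enum_enum (T : finType) : index_enum T = enum T.
Proof. by rewrite enumT /index_enum unlock. Qed.

Section FlagSum.
Variables (A : nzRingType) (a b : A) (N : nat).
Implicit Types S T : {set 'I_N}.

(** For x = a this is u_S; for x = e it is the word contributed by a chain with rank set S. *)
Definition set_word x S : A := \prod_(i < N) (if i \in S then b else x).

Lemma set_word_subB T :
  set_word (a - b) T = \sum_(S : {set 'I_N} | T \subset S)
    set_word a S *~ (-1) ^+ #|S :\: T|.
Proof.
(* The choice true at i takes the letter b, with sign -1 off T, and false takes a; the value 0 on T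
   discards the sets S that do not contain T. *)
pose F i (x : bool) := if x then (if i \in T then b else - b) else (if i \in T then 0 else a).
transitivity (\prod_(i < N) \sum_(x : bool) F i x).
  apply: eq_bigr => i _; rewrite big_bool /F /=.
  by case: ifP => _; rewrite ?addr0 // addrC.
rewrite bigA_distr_bigA /=.
rewrite (reindex_onto (fun S : {set 'I_N} => [ffun i => i \in S])
                      (fun f => [set i | f i])) /=; last first.
  by move=> f _; apply/ffunP => i; rewrite ffunE inE.
rewrite [RHS]big_mkcond; apply: eq_big => [S|S _].
  by apply/eqP/setP => i; rewrite inE ffunE.
case: ifPn => [/fintype.subsetP TS|].
  rewrite /set_word; have -> : (-1) ^+ #|S :\: T| =
      \prod_(i < N) (if i \in S :\: T then -1 else 1 : int).
    by rewrite -big_mkcond prodr_const.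
  rewrite -prodr_mulrz; apply: eq_bigr => i _; rewrite ffunE /F !inE.
  have := TS i; case: (i \in S); case: (i \in T) => //= H; rewrite ?mulr1z ?mulrN1z //.
  by have := H isT.
move=> /subsetPn[i iT iS].
have [s1 [s2 ->]] : exists s1 s2, index_enum 'I_N = s1 ++ i :: s2.
  by have /splitPr[s1 s2] := mem_index_enum i; exists s1, s2.
by rewrite big_cat big_cons /= ffunE /F (negPf iS) iT mul0r mulr0.
Qed.

(** Exchanging the sums and applying [set_word_subB] absorbs the inclusion-exclusion of h into the
    letter a - b. *)
Lemma sum_flag_h (f : {set 'I_N} -> nat) :
  \sum_S set_word a S *~ (\sum_(T in powerset S) (-1) ^+ #|S :\: T| * (f T)%:R)
    = \sum_T set_word (a - b) T *+ f T.
Proof.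
under eq_bigr => S _.
  rewrite raddf_sum /=.
  under eq_bigl do rewrite powersetE.
over.
rewrite (exchange_big_dep predT) //=; apply: eq_bigr => T _.
rewrite set_word_subB -sumrMnl; apply: eq_bigr => S _.
by rewrite mulrzA natz.
Qed.

End FlagSum.

(** Rank sets become lists of bits, so that sums over them unfold at the lowest rank or at the
    highest. *)
Fixpoint bitseqs (k : nat) : seq (seq bool) :=
  if k is k'.+1 then map (cons true) (bitseqs k') ++ map (cons false) (bitseqs k')
  else [:: [::]].

Lemma mem_bitseqs k bs : (bs \in bitseqs k) = (size bs == k).
Proof.
elim: k bs => [|k IH] [|x bs]; rewrite /= ?inE ?mem_cat //.
  by apply/negP => /orP[] /mapP[].
have inj y : injective (cons y : seq bool -> seq bool) by move=> ? ? [].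
have no y : x != y -> (x :: bs \in map (cons y) (bitseqs k)) = false.
  by move=> xy; apply/mapP => -[u _ [xy' _]]; rewrite xy' eqxx in xy.
by rewrite eqSS -IH; case: x no => no; [rewrite (no false) // orbF|rewrite (no true)]; rewrite ?mem_map.
Qed.

Lemma uniq_bitseqs k : uniq (bitseqs k).
Proof.
elim: k => //= k IH; rewrite cat_uniq !map_inj_uniq ?IH; try by move=> ? ? [].
by rewrite andbT; apply/hasPn => _ /mapP[x _ ->]; apply/mapP => -[].
Qed.

Lemma perm_bitseqs_rcons k : perm_eq (bitseqs k.+1)
  (map (rcons^~ true) (bitseqs k) ++ map (rcons^~ false) (bitseqs k)).
Proof.
apply: uniq_perm; rewrite ?uniq_bitseqs //.
  rewrite cat_uniq !map_inj_uniq ?uniq_bitseqs; try by move=> ? ? /rcons_inj[].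
  by rewrite andbT; apply/hasPn => _ /mapP[x _ ->]; apply/mapP => -[y _ /rcons_inj[]].
move=> bs; rewrite mem_bitseqs mem_cat; case/lastP: bs => [|bs x].
  by apply/esym/negP => /orP[] /mapP[[]].
rewrite size_rcons eqSS -mem_bitseqs; apply/idP/orP.
  by case: x => bsk; [left|right]; apply/mapP; exists bs.
by case=> /mapP[y yk /rcons_inj[-> _]].
Qed.

Section BitSum.
Variables (V : nmodType).

Lemma sum_set_bits N (G : seq bool -> V) :
  \sum_(T : {set 'I_N}) G [seq i \in T | i <- enum 'I_N] =
  \sum_(bs <- bitseqs N) G bs.
Proof.
rewrite -(big_map (fun T : {set 'I_N} => [seq i \in T | i <- enum 'I_N]) predT G).
apply: perm_big; apply: uniq_perm; rewrite ?uniq_bitseqs //.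
  rewrite map_inj_in_uniq ?index_enum_uniq // => S T _ _ ST; apply/setP => i.
  by move/eq_in_map: ST; apply; rewrite mem_enum.
move=> bs; rewrite mem_bitseqs; apply/mapP/eqP => [[T _ ->]|sz].
  by rewrite size_map size_enum_ord.
exists [set i : 'I_N | nth false bs i]; first by rewrite mem_index_enum.
apply: (@eq_from_nth _ false); first by rewrite size_map size_enum_ord.
move=> i; rewrite sz => iN; rewrite (nth_map (Ordinal iN)) ?size_enum_ord //.
by rewrite inE nth_enum_ord.
Qed.

Lemma sum_bitseqsS k (G : seq bool -> V) : \sum_(bs <- bitseqs k.+1) G bs =
  \sum_(bs <- bitseqs k) G (true :: bs) + \sum_(bs <- bitseqs k) G (false :: bs).
Proof. by rewrite big_cat !big_map. Qed.

Lemma sum_bitseqsSr k (G : seq bool -> V) : \sum_(bs <- bitseqs k.+1) G bs =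
  \sum_(bs <- bitseqs k) G (rcons bs true) + \sum_(bs <- bitseqs k) G (rcons bs false).
Proof. by rewrite (perm_big _ (perm_bitseqs_rcons k)) big_cat !big_map. Qed.

End BitSum.

(** * Chains with prescribed ranks *)

Section Chains.
Variable P : ranked_poset.
Implicit Types x y z : rp_type P.

(** The flag numbers of the interval from x to z, in a form that recurses on the lowest rank. *)
Fixpoint chains x (s : seq nat) z : nat :=
  if s is r :: s' then
    (\sum_(y : rp_elts P | rp_lt x (val y) && (rp_rank (val y) == r))
       chains (val y) s' z)%N
  else rp_lt x z.

Lemma chains_rcons x s r z : chains x (rcons s r) z =
  (\sum_(y : rp_elts P | rp_lt (val y) z && (rp_rank (val y) == r))
     chains x s (val y))%N.
Proof.
elim: s x => [|q s IH] x /=.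
  rewrite big_mkcond [RHS]big_mkcond; apply: eq_bigr => y _.
  by case: rp_lt; case: rp_lt; case: eqP.
under eq_bigr do rewrite IH.
by rewrite exchange_big.
Qed.

Lemma card_chains k s x z : size s = k ->
  #|[pred t : k.-tuple (rp_elts P) |
      path (@rp_lt P) x (rcons [seq val u | u <- t] z)
      && ([seq rp_rank (val u) | u <- t] == s)]| = chains x s z.
Proof.
elim: s k x => [|r s IH] [|k] x //=.
  move=> _; rewrite -sum1_card (eq_bigl (fun t => (t == [tuple]) && rp_lt x z)).
    by case: (rp_lt x z); rewrite ?(big_pred0_eq, big_pred1_eq) //;
      [rewrite (eq_bigl (pred1 [tuple])) ?big_pred1_eq // => t; rewrite andbT
      |rewrite big_pred0 // => t; rewrite andbF].
  by move=> t; rewrite [t]tuple0 inE /= !andbT.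
move=> [sk]; rewrite -sum1_card.
rewrite (reindex (fun p : rp_elts P * k.-tuple (rp_elts P) => cons_tuple p.1 p.2)) /=; last first.
  exists (fun t : k.+1.-tuple (rp_elts P) => (thead t, behead_tuple t)).
    by case=> y t _; congr pair; apply/val_inj.
  by move=> t _; rewrite [t in RHS]tuple_eta; apply/val_inj.
under [RHS]eq_bigr => y _ do rewrite -(IH k) // -sum1_card.
rewrite pair_big_dep; apply: eq_bigl => -[y t].
rewrite !inE /= eqseq_cons; case: (rp_lt x) => //=.
by rewrite andbCA.
Qed.

Lemma flag_f_chains (T : {set 'I_(rp_N P)}) :
  flag_f T = chains (rp_bot P) [seq (val i).+1 | i <- enum T] (rp_top P).
Proof. by rewrite -(@card_chains #|T|) // size_map -cardE. Qed.

End Chains.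

(** * Chain sums and their recursions *)

Section ChainSums.
Variables (P : ranked_poset) (A : nzRingType) (e b : A).

Definition letter (x : bool) := if x then b else e.

(* The bits [bs] tell which of the ranks i + 1, ..., i + k are occupied. *)
Definition chain_sum k x i z : A :=
  \sum_(bs <- bitseqs k)
    (\prod_(x <- bs) letter x) *+ chains (P := P) x (map S (mask bs (iota i k))) z.

(** The letters are read from the highest rank down, so that peeling off the largest element of a
    chain is a left multiplication, as peeling off the least one is in [chain_sum]. *)
Definition chain_sum_rev k x z : A :=
  \sum_(bs <- bitseqs k)
    (\prod_(x <- rev bs) letter x) *+ chains (P := P) x (map S (mask bs (iota 0 k))) z.

Lemma chain_sum0 x i z : chain_sum 0 x i z = (rp_lt x z)%:R.
Proof. by rewrite /chain_sum big_seq1 big_nil. Qed.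

Lemma chain_sum_rev0 x z : chain_sum_rev 0 x z = (rp_lt x z)%:R.
Proof. by rewrite /chain_sum_rev big_seq1 big_nil. Qed.

Lemma chain_sumS k x i z : chain_sum k.+1 x i z =
  e * chain_sum k x i.+1 z +
  b * \sum_(y : rp_elts P | rp_lt x (val y) && (rp_rank (val y) == i.+1))
        chain_sum k (val y) i.+1 z.
Proof.
rewrite /chain_sum sum_bitseqsS addrC; congr (_ + _).
  by rewrite mulr_sumr; apply: eq_bigr => bs _; rewrite big_cons /= -mulrnAr.
rewrite exchange_big mulr_sumr /=; apply: eq_bigr => bs _.
by rewrite big_cons /= -mulrnAr; congr (_ * _); rewrite -sumrMnr.
Qed.

Lemma mask_iota_rcons k bs x : size bs = k ->
  map S (mask (rcons bs x) (iota 0 k.+1)) =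
  (if x then rcons^~ k.+1 else id) (map S (mask bs (iota 0 k))).
Proof.
have -> : iota 0 k.+1 = rcons (iota 0 k) k by rewrite -addn1 iotaD cats1.
move=> sz; rewrite mask_rcons ?size_iota //.
by rewrite map_cat; case: x; rewrite /= ?cats1 ?cats0.
Qed.

Lemma chain_sum_revS k x z : chain_sum_rev k.+1 x z =
  e * chain_sum_rev k x z +
  b * \sum_(y : rp_elts P | rp_lt (val y) z && (rp_rank (val y) == k.+1))
        chain_sum_rev k x (val y).
Proof.
rewrite /chain_sum_rev sum_bitseqsSr addrC; congr (_ + _).
  rewrite mulr_sumr big_seq [RHS]big_seq; apply: eq_bigr => bs.
  rewrite mem_bitseqs => /eqP szbs.
  by rewrite mask_iota_rcons // rev_rcons big_cons -mulrnAr.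
rewrite exchange_big mulr_sumr /= big_seq [RHS]big_seq; apply: eq_bigr => bs.
rewrite mem_bitseqs => /eqP szbs.
by rewrite mask_iota_rcons // rev_rcons big_cons -mulrnAr /= chains_rcons -sumrMnr.
Qed.

End ChainSums.

Lemma word_prod s : word s = \prod_(x <- s) (if x then ab_b else ab_a).
Proof.
elim: s => [|x s IH]; first by rewrite big_nil word_nil.
by rewrite big_cons word_cons IH; case: x.
Qed.

Lemma ab_index_chains P :
  ab_index P = chain_sum (P := P) ab_e ab_b (rp_N P) (rp_bot P) 0 (rp_top P).
Proof.
rewrite /ab_index.
transitivity (\sum_S set_word ab_b ab_a S *~ @flag_h P S).
  apply: eq_bigr => S _; rewrite scale_intE; congr (_ *~ _).
  by rewrite /ab_monomial word_prod big_map -index_enum_enum.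
rewrite sum_flag_h /chain_sum -sum_set_bits; apply: eq_bigr => T _.
rewrite flag_f_chains -val_enum_ord -map_mask -filter_mask /set_word.
rewrite big_map -index_enum_enum /= -map_comp; congr (_ *+ chains _ _ _).
Qed.

(** * Reversal of words *)

Lemma ab_revB p q : ab_rev (p - q) = ab_rev p - ab_rev q.
Proof. exact: (raddfB ab_rev). Qed.

Lemma ab_rev_word w : ab_rev (word w) = word (rev w).
Proof. exact: (word_ext_word (fun w => word (rev w))). Qed.

Lemma ab_rev_mul_letter p x : ab_rev (p * word [:: x]) = word [:: x] * ab_rev p.
Proof.
elim/Zab_ind: p => [w|p q IHp IHq].
  by rewrite -word_cat !ab_rev_word rev_cat word_cat.
by rewrite (mulrBl (word [:: x]) p q) !ab_revB IHp IHq mulrBr.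
Qed.

Lemma ab_rev_mul_e p : ab_rev (p * ab_e) = ab_e * ab_rev p.
Proof.
rewrite /ab_e (mulrBr p ab_a ab_b) ab_revB (mulrBl (ab_rev p) ab_a ab_b).
exact: (congr2 (fun u v => u - v) (ab_rev_mul_letter p false)
                                  (ab_rev_mul_letter p true)).
Qed.

Lemma ab_rev_prod_letter s :
  ab_rev (\prod_(x <- rev s) letter ab_e ab_b x) = \prod_(x <- s) letter ab_e ab_b x.
Proof.
elim: s => [|[] s IH]; first by rewrite !big_nil -word_nil ab_rev_word.
  by rewrite rev_cons big_rcons big_cons -IH /=; exact: ab_rev_mul_letter.
by rewrite rev_cons big_rcons big_cons -IH /=; exact: ab_rev_mul_e.
Qed.

(** Reversal fixes e and b, so it exchanges the two reading directions of a chain. The reversal in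
    the theorem comes from here. *)
Lemma ab_rev_chain_sum P k (x z : rp_type P) :
  ab_rev (chain_sum_rev ab_e ab_b k x z) = chain_sum ab_e ab_b k x 0 z.
Proof.
rewrite (raddf_sum ab_rev); apply: eq_bigr => s _.
exact: (etrans (raddfMn ab_rev _ _) (congr1 (fun q => q *+ _) (ab_rev_prod_letter s))).
Qed.

Section Jump.
Variables (A : nzRingType) (e b : A) (I : finType) (d : I -> nat).

(** Iterates the one-step recursion, sorting the terms by the y at which the leftmost b is taken;
    every later step puts an e in front. *)
Lemma chain_jump (a : nat -> A) (c0 : int) (Q : pred I) (N : I -> int)
    (B : nat -> I -> A) K :
    (forall x, (0 < d x)%N) -> a 0%N = 1 *~ c0 ->
    (forall k, (k < K)%N -> a k.+1 =
      e * a k + b * \sum_(y | Q y && (d y == k.+1)) B k y *~ N y) ->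
  forall k, (k <= K)%N -> a k =
    e ^+ k *~ c0 +
    \sum_(y | Q y && (d y <= k)%N) (e ^+ (k - d y) * (b * B (d y).-1 y)) *~ N y.
Proof.
move=> d0 a0 aS; elim=> [|k IH] kK.
  rewrite a0 expr0 big_pred0 ?addr0 // => y; rewrite leqn0.
  by case: (d y) (d0 y) => //= *; rewrite andbF.
rewrite aS // IH ?(ltnW kK) // mulrDr mulrzAr -exprS -addrA; congr (_ + _).
rewrite mulr_sumr [RHS](bigID (fun y => d y <= k)%N) /= mulr_sumr; congr (_ + _).
  apply: eq_big => y; first by rewrite -andbA; case: (Q y) => //=; lia.
  by move=> /andP[_ yk]; rewrite mulrzAr (mulrA e) -exprS subSn.
apply: eq_big => y; first by rewrite -andbA; case: (Q y) => //=; lia.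
by move=> /andP[_ /eqP ->]; rewrite mulrzAr subnn expr0 mul1r.
Qed.

End Jump.

(** * Face counts determined by Euler relations *)

Section FaceCounts.
(** [I] stands for the flats of positive dimension under reverse inclusion, [J] for the unbounded
    faces under inclusion in closures, [z F] for the span of F and [d] for the dimension. *)
Variables (I J : finType) (d : I -> nat) (le : rel I) (z : J -> I) (leJ : rel J).
Hypothesis le_refl : reflexive le.
Hypothesis le_trans : transitive le.
Hypothesis le_d : forall x y, le x y -> x != y -> (d y < d x)%N.
Hypothesis d_gt0 : forall x, (0 < d x)%N.
Hypothesis leJ_refl : reflexive leJ.
Hypothesis leJ_z : forall F G, leJ F G -> le (z G) (z F).
Hypothesis leJ_eq : forall F G, leJ F G -> z F = z G -> F = G.

Hypothesis euler_local : forall F x, le x (z F) ->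
  \sum_(G | leJ F G && le x (z G)) (-1) ^+ d (z G) = (-1) ^+ d x :> int.
Hypothesis euler_global : forall x,
  \sum_(G | le x (z G)) (-1) ^+ d (z G) = (-1) ^+ d x - 1 :> int.

Definition strict x y := le x y && (x != y).

Lemma strict_trans : transitive strict.
Proof.
move=> y x w /andP[xy nxy] /andP[yw nyw]; rewrite /strict (le_trans xy) //=.
apply/eqP => E; rewrite -E in yw; have := le_d xy nxy.
by rewrite -E in nyw; have := le_d yw nyw; lia.
Qed.

Lemma strict_d x y : strict x y -> (d y < d x)%N.
Proof. by move=> /andP[]; apply: le_d. Qed.

Definition face_count F x : int := \sum_(G | leJ F G && (z G == x)) 1.
Definition flat_count x : int := \sum_(G | z G == x) 1.

Lemma sum_by_flat (P : pred J) x :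
  \sum_(G | P G && le x (z G)) (-1) ^+ d (z G) =
  \sum_(y | le x y) (-1) ^+ d y * (\sum_(G | P G && (z G == y)) 1) :> int.
Proof.
rewrite (partition_big z (le x)) /=; last by move=> G /andP[].
apply: eq_bigr => y xy; rewrite mulr_sumr.
apply: eq_big => G; first by case: eqP => [->|]; rewrite ?andbF // xy andbT.
by move=> /andP[_ /eqP ->]; rewrite mulr1.
Qed.

Lemma sign_cancel (a : nat) (x y : int) :
  (-1) ^+ a * x + y = (-1) ^+ a -> x = 1 - (-1) ^+ a * y.
Proof.
move=> E; have : (-1) ^+ a * ((-1) ^+ a * x + y) = 1 by rewrite E -expr2 sqrr_sign.
rewrite mulrDr mulrA -expr2 sqrr_sign mul1r => E'.
by rewrite -[x](addrK ((-1) ^+ a * y)) E'.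
Qed.

Lemma face_count_self F : face_count F (z F) = 1.
Proof.
rewrite /face_count (big_pred1 F) // => G /=; apply/andP/eqP => [[FG /eqP E]|->].
  by rewrite (leJ_eq FG).
by rewrite leJ_refl eqxx.
Qed.

Lemma face_count_out F x : ~~ le x (z F) -> face_count F x = 0.
Proof.
move=> nx; rewrite /face_count big_pred0 // => G; apply/andP => -[FG /eqP E].
by rewrite -E leJ_z in nx.
Qed.

(** Solve the local Euler relation for its term y = x. The term y = z F has count 1 and gives [eps];
    flats that are not below z F contribute 0. *)
Lemma face_count_rec F x : strict x (z F) -> face_count F x = 1 + eps (d x + d (z F)) +
   \sum_(y | strict x y && strict y (z F)) eps (d x + d y) * face_count F y.
Proof.
move=> /andP[xF nxF]; have := euler_local xF; rewrite sum_by_flat.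
rewrite (bigD1 x) //= -/(face_count F x) => /sign_cancel ->.
rewrite -addrA; congr (_ + _).
rewrite (bigD1 (z F)) ?xF 1?eq_sym //= -/(face_count F (z F)) face_count_self mulr1 mulrDr opprD.
rewrite -exprD; congr (_ + _).
rewrite mulr_sumr -sumrN [LHS](bigID (fun y => le y (z F))) /= addrC big1 ?add0r.
  apply: eq_big => y.
    by rewrite /strict [x == y]eq_sym -!andbA; congr [&& _, _ & _]; exact: andbC.
  by move=> _; rewrite mulrA -exprD mulNr.
by move=> y /andP[_ ny]; rewrite -/(face_count F y) face_count_out // !mulr0 oppr0.
Qed.

(** In the global relation the constant -1, moved to the left, acts like one more flat of dimension
    0 and count 1. *)
Lemma flat_count_rec x : flat_count x = 1 + eps (d x) + \sum_(y | strict x y) eps (d x + d y) * flat_count y.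
Proof.
have := euler_global x.
have -> : \sum_(G | le x (z G)) (-1) ^+ d (z G) =
          \sum_(y | le x y) (-1) ^+ d y * flat_count y :> int.
  exact: (sum_by_flat predT).
move/(congr1 (+%R^~ 1)); rewrite /= subrK (bigD1 x) //= -addrA => /sign_cancel ->.
rewrite -!addrA; congr (_ + _); rewrite mulrDr mulr1 opprD addrC; congr (_ + _).
rewrite mulr_sumr -sumrN; apply: eq_big => y; first by rewrite /strict eq_sym.
by move=> _; rewrite mulrA -exprD mulNr.
Qed.

(* Solving the recursion beforehand spares the proof that every flat is the span
   of some unbounded face. *)
Lemma count_exists : exists N : I -> I -> int, forall x y, strict x y ->
  N x y = 1 + eps (d x + d y) + \sum_(w | strict x w && strict w y) eps (d x + d w) * N w y.
Proof.
suff main k : exists N : I -> I -> int, forall x y, (d x < k)%N -> strict x y ->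
    N x y = 1 + eps (d x + d y) + \sum_(w | strict x w && strict w y) eps (d x + d w) * N w y.
  have [N NP] := main (\max_x d x).+1.
  by exists N => x y; apply: NP; rewrite ltnS; apply: leq_bigmax.
elim: k => [|k [N NP]]; first by exists (fun _ _ => 0).
exists (fun x y => if (d x < k)%N then N x y else
  1 + eps (d x + d y) + \sum_(w | strict x w && strict w y) eps (d x + d w) * N w y) => x y.
rewrite ltnS => xk xy.
rewrite [in RHS](eq_bigr (fun w => eps (d x + d w) * N w y)); last first.
  by move=> w /andP[/strict_d dw _]; rewrite (leq_trans dw xk).
by case: ifP => // dk; apply: NP.
Qed.

(** The recursion sees F only through [z F]; hence the number of faces above F with a given span
    depends only on the span of F. *)
Lemma face_count_unique N : (forall x y, strict x y ->
    N x y = 1 + eps (d x + d y) + \sum_(w | strict x w && strict w y) eps (d x + d w) * N w y) ->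
  forall F x, strict x (z F) -> face_count F x = N x (z F).
Proof.
move=> NP F x; have [k] := ubnP (d x); elim: k x => // k IH x xk xF.
rewrite face_count_rec // NP //; congr (_ + _); apply: eq_bigr => y /andP[xy yF].
by rewrite IH // (leq_trans (strict_d xy)).
Qed.

Variables (A : nzRingType) (a b : A) (w : {additive A -> A}).
Let c := a + b.
Let e := a - b.
Hypothesis w1 : w 1 = 1.
Hypothesis w_a : w a = c.
Hypothesis w_bM : forall p, w (b * p) = c * w p.
Hypothesis w_aaM : forall p, w (a * (a * p)) = c * w (a * p).
Hypothesis w_abM : forall p, w (a * (b * p)) = (a * b + b * a) *+ 2 * w p.

Variables (n : nat) (x0 : I).
Hypothesis d_x0 : d x0 = n.
Hypothesis x0_le : forall x, le x0 x.

(** [psi k x] models the chain sum from the flat x up through the dimensions k to 1, [D k G] that of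
    the faces of ranks 1 to k below G, and [T k] that of all faces of these ranks. *)
Variables (psi : nat -> I -> A) (D : nat -> J -> A) (T : nat -> A).
Hypothesis psi0 : forall x, psi 0%N x = 1.
Hypothesis psiS : forall k x, (k.+1 < n)%N ->
  psi k.+1 x = e * psi k x + b * \sum_(y | strict x y && (d y == k.+1)) psi k y.
Hypothesis D0 : forall G, D 0%N G = 1.
Hypothesis DS : forall k G, (k < n)%N -> D k.+1 G =
  e * D k G + b * \sum_(F | (leJ F G && (F != G)) && (d (z F) == k.+1)) D k F.
Hypothesis T0 : T 0%N = 1.
Hypothesis TS : forall k, (k < n)%N -> T k.+1 =
  e * T k + b * \sum_(F | d (z F) == k.+1) D k F.

Lemma d_le_n x : (d x <= n)%N.
Proof. by rewrite -d_x0; have [->//|nx] := eqVneq x0 x; apply/ltnW/le_d. Qed.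

(** Chains of faces have n free ranks and chains of flats n - 1; the factor a makes up for the
    missing letter. *)
Theorem chain_sums_omega : T n = w (a * psi n.-1 x0).
Proof.
have [N NP] := count_exists; have cN := face_count_unique NP.
(* [Ak k x] collects the faces spanning x; [g] stops at [d x] - 1, the last rank available below
   such a face. *)
pose Ak k x : A := \sum_(G | z G == x) D k G.
pose g x := Ak (d x).-1 x.
have leN F G : leJ F G && (F != G) = leJ F G && strict (z G) (z F).
  rewrite /strict; apply/andP/and3P => [[FG nFG]|[FG _ nzz]]; split=> //.
  - exact: leJ_z.
  - by apply: contraNneq nFG => E; rewrite (leJ_eq FG).
  - by apply: contraNneq nzz => ->.
(* Exchange the sums: a face F spanning y lies below exactly [N x y] faces G spanning x. *)
have AS k x : (k < n)%N -> Ak k.+1 x =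
    e * Ak k x + b * \sum_(y | strict x y && (d y == k.+1)) Ak k y *~ N x y.
  move=> kn; rewrite /Ak.
  under eq_bigr do rewrite DS //.
  rewrite big_split /= -!mulr_sumr; congr (_ + b * _).
  rewrite (exchange_big_dep (fun F => strict x (z F) && (d (z F) == k.+1))) /=; last first.
    by move=> G F /eqP <-; rewrite leN => /andP[/andP[_ ->] ->].
  rewrite (partition_big z (fun y => strict x y && (d y == k.+1))) //=.
  apply: eq_bigr => y /andP[xy yk].
  rewrite [RHS]mulrz_suml; apply: eq_big => F.
    by case: (z F =P y) => [->|]; rewrite ?andbF // xy yk.
  move=> /andP[/andP[xF Fk] /eqP zF]; rewrite -zF -(cN F x xF) /face_count raddf_sum /=.
  rewrite mulr1z; apply: eq_bigl => G; rewrite leN Fk andbT.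
  by case: (z G =P x) => [->|]; rewrite ?andbF //= xF !andbT.
have A0 x : Ak 0%N x = 1 *~ flat_count x.
  by rewrite /Ak /flat_count raddf_sum /=; apply: eq_bigr => G _; rewrite D0.
have g_rec x : g x = e ^+ (d x).-1 *~ flat_count x +
    \sum_(y | strict x y) (e ^+ (d x - d y).-1 * (b * g y)) *~ N x y.
  rewrite {1}/g (chain_jump d_gt0 (A0 x) (fun k => @AS k x) (k := (d x).-1) (K := n)).
    congr (_ + _); apply: eq_big => y.
      by rewrite andb_idr // => /strict_d; lia.
    by move=> /andP[/strict_d dd _]; rewrite /g; congr (_ ^+ _ * _ *~ _); lia.
  by have := d_le_n x; lia.
have psi_rec x : psi (d x).-1 x = e ^+ (d x).-1 +
    \sum_(y | strict x y) e ^+ (d x - d y).-1 * (b * psi (d y).-1 y).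
  rewrite (chain_jump (a := psi^~ x) (b := b) (e := e) (c0 := 1) (Q := strict x) (N := fun=> 1) (B := psi)
     d_gt0 _ _ (k := (d x).-1) (K := n.-1)).
  - rewrite mulr1z; congr (_ + _); apply: eq_big => y.
      by rewrite andb_idr // => /strict_d; lia.
    by move=> /andP[/strict_d dd _]; rewrite mulr1z; congr (_ ^+ _ * _); lia.
  - by rewrite psi0.
  - by move=> k kn; rewrite psiS; [congr (_ + _ * _); apply: eq_bigr|lia].
  - by have := d_le_n x; lia.
(* Sort the chains by the span of their largest face; the chain without faces gives e^n. *)
have TE : T n = e ^+ n + \sum_x e ^+ (n - d x) * (b * g x).
  rewrite (chain_jump (a := T) (b := b) (e := e) (c0 := 1) (Q := predT) (N := fun=> 1) (B := Ak)
     d_gt0 _ _ (k := n) (K := n)) //=.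
  - rewrite mulr1z; congr (_ + _); apply: eq_big => y; first by rewrite d_le_n.
    by move=> _; rewrite mulr1z.
  - move=> k kn; rewrite TS //; congr (_ + b * _).
    rewrite (partition_big z (fun y => d y == k.+1)) //=; apply: eq_bigr => y yk.
    rewrite mulr1z; apply: eq_bigl => F.
    by case: (z F =P y) => [->|]; rewrite ?andbF // yk.
rewrite TE; have -> : psi n.-1 x0 = psi (d x0).-1 x0 by rewrite d_x0.
apply: (sum_eX_g w1 w_a w_bM w_aaM w_abM d_gt0 strict_trans strict_d NP flat_count_rec psi_rec g_rec d_x0).
by move=> x nx; rewrite /strict x0_le eq_sym.
Qed.

End FaceCounts.

Local Open Scope classical_set_scope.

(** * Cells of affine forms *)

Section Cells.
Variables (R : realType) (n : nat).
Local Notation pt := 'rV[R]_n.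
Local Notation aform := (pt * R)%type.
Implicit Types (h : aform) (p q v : pt) (C : set pt) (L : seq aform).

Definition dot (u v : pt) : R := \sum_(j < n) u ord0 j * v ord0 j.
Definition aeval h p : R := dot h.1 p - h.2.

Lemma dotDr u v w : dot u (v + w) = dot u v + dot u w.
Proof. by rewrite -big_split; apply: eq_bigr => j _; rewrite mxE mulrDr. Qed.

Lemma dotZr u a v : dot u (a *: v) = a * dot u v.
Proof. by rewrite mulr_sumr; apply: eq_bigr => j _; rewrite mxE mulrCA. Qed.

Lemma dotBr u v w : dot u (v - w) = dot u v - dot u w.
Proof. by rewrite -scaleN1r dotDr dotZr mulN1r. Qed.

Lemma aevalD h p v : aeval h (p + v) = aeval h p + dot h.1 v.
Proof. by rewrite /aeval dotDr addrAC. Qed.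

Definition segpt (t : R) p q : pt := p + t *: (q - p).

Lemma aeval_segpt h t p q : aeval h (segpt t p q) = (1 - t) * aeval h p + t * aeval h q.
Proof. by rewrite /segpt aevalD dotZr dotBr /aeval; lra. Qed.

(* [tame V C]: the set C is convex, and relatively open in a translate of the
   row space of V. *)
Record tame (V : 'M[R]_n) C : Prop := Tame {
  tame_dir : forall p q, C p -> C q -> (q - p <= V)%MS;
  tame_open : forall p v, C p -> (v <= V)%MS ->
    exists2 d : R, 0 < d & forall t : R, `|t| <= d -> C (p + t *: v);
  tame_convex : forall p q (t : R), C p -> C q -> 0 <= t <= 1 -> C (segpt t p q)
}.

Definition is_tame C := exists V, tame V C.

Definition cut (s : R) h C : set pt := C `&` [set p | Num.sg (aeval h p) = s].

Lemma cut_sub s h C : cut s h C `<=` C.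
Proof. by move=> p []. Qed.

Lemma sg_val (x : R) : [\/ Num.sg x = 1, Num.sg x = 0 | Num.sg x = -1].
Proof. by case: (sgrP x) => _; [constructor 2|constructor 1|constructor 3]. Qed.

Lemma tame_cut_open V h C s : s != 0 -> tame V C -> tame V (cut s h C).
Proof.
move=> s0 [dirC opC cvC]; split.
- by move=> p q [Cp _] [Cq _]; apply: dirC.
- move=> p v [Cp sp] Vv; have [d d0 Cd] := opC p v Cp Vv.
  have hp0 : aeval h p != 0 by rewrite -sgr_eq0 sp.
  (* Steps up to a/(2k) change the form by at most a/2, too little to reach 0; the summand 1 keeps k
     positive when v is parallel to the hyperplane. *)
  pose a := `|aeval h p|; have a0 : 0 < a by rewrite normr_gt0.
  pose k := `|dot h.1 v| + 1; have k0 : 0 < k by rewrite ltr_wpDl.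
  exists (Num.min d (a / (2 * k))).
    by rewrite lt_min d0 divr_gt0 // mulr_gt0.
  move=> t; rewrite le_min => /andP[td tk]; split; first exact: Cd.
  rewrite /= aevalD dotZr -sp.
  have tb : `|t * dot h.1 v| < a.
    rewrite normrM; have: `|t| * k <= a / 2.
      have := ler_wpM2r (ltW k0) tk.
      by have -> : a / (2 * k) * k = a / 2 by field; rewrite gt_eqF.
    have : `|t| * `|dot h.1 v| <= `|t| * k by rewrite ler_wpM2l // lerDl.
    by lra.
  move: tb; rewrite /a; set x := aeval h p; set y := t * _ => tb.
  have [x0|x0] := ltrP x 0.
    move: tb; rewrite (ltr0_norm x0) ltr_norml => /andP[? ?].
    by rewrite !ltr0_sg //; lra.
  have {}x0 : 0 < x by rewrite lt_neqAle eq_sym hp0.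
  move: tb; rewrite (gtr0_norm x0) ltr_norml => /andP[? ?].
  by rewrite !gtr0_sg //; lra.
- move=> p q t [Cp sp] [Cq sq] t01; split; first exact: cvC.
  rewrite /= aeval_segpt; case: (sg_val (aeval h p)) => sp'.
  + have sE : s = 1 by rewrite -sp.
    rewrite sE in sq *; apply/eqP; rewrite sgr_cp0.
    move/eqP: sp'; move/eqP: sq; rewrite !sgr_cp0 => ? ?.
    by nra.
  + by move: sp; rewrite /= sp' => sE; rewrite -sE eqxx in s0.
  + have sE : s = -1 by rewrite -sp.
    rewrite sE in sq *; apply/eqP; rewrite sgr_cp0.
    move/eqP: sp'; move/eqP: sq; rewrite !sgr_cp0 => ? ?.
    by nra.
Qed.

Definition hker h : 'M[R]_n := kermx (h.1)^T.

Lemma sub_hker h v : (v <= hker h)%MS = (dot h.1 v == 0).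
Proof.
have E : v *m h.1^T = (dot h.1 v)%:M.
  apply/matrixP => i j; rewrite !ord1 !mxE mulr1n; apply: eq_bigr => k _.
  by rewrite mxE mulrC.
apply/sub_kermxP/eqP => [|E0]; rewrite E; last by rewrite E0 raddf0.
by move/matrixP/(_ ord0 ord0); rewrite !mxE mulr1n.
Qed.

Lemma tame_cut0 V h C : tame V C -> tame (V :&: hker h)%MS (cut 0 h C).
Proof.
move=> [dirC opC cvC].
have s0 p : Num.sg (aeval h p) = 0 <-> aeval h p = 0.
  by split=> [/eqP|->]; rewrite ?sgr_eq0 ?sgr0 // => /eqP.
split.
- move=> p q [Cp /s0 p0] [Cq /s0 q0]; rewrite sub_capmx dirC // sub_hker dotBr.
  by move: p0 q0; rewrite /aeval => ? ?; apply/eqP; lra.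
- move=> p v [Cp /s0 p0]; rewrite sub_capmx sub_hker => /andP[Vv /eqP v0].
  have [d d0 Cd] := opC p v Cp Vv; exists d => // t td; split; first exact: Cd.
  by apply/s0; rewrite aevalD dotZr v0 p0 mulr0 addr0.
- move=> p q t [Cp /s0 p0] [Cq /s0 q0] t01; split; first exact: cvC.
  by apply/s0; rewrite aeval_segpt p0 q0 !mulr0 addr0.
Qed.

Lemma is_tame_cut s h C : is_tame C -> is_tame (cut s h C).
Proof.
move=> [V tC]; have [->|s0] := eqVneq s 0; first by exists (V :&: hker h)%MS; apply: tame_cut0.
by exists V; apply: tame_cut_open.
Qed.

(** Differences of points of C lie in V, which bounds the dimension; conversely, small multiples of
    a basis of V, added to a point of C, stay inside C. *)
Lemma affdim_tame V C : tame V C -> C !=set0 -> affdim C = \rank V.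
Proof.
move=> [dirC opC cvC] [p Cp]; apply/eqP; rewrite eqn_leq; apply/andP; split.
  apply/bigmax_leqP => k /asboolP[x [M [freeM Cx CM]]].
  rewrite -(eqP freeM : _ = k :> nat); apply: mxrankS.
  apply/row_subP => i; have := dirC _ _ Cx (CM i).
  by rewrite addrC addKr.
have rn : (\rank V < n.+1)%N by rewrite ltnS rank_leq_col.
apply: (leq_bigmax_cond (Ordinal rn)); apply/asboolP.
pose B := row_base V.
have /choice[d dP] : forall i : 'I_(\rank V), exists d : R, 0 < d /\ C (p + d *: row i B).
  move=> i; have iV : (row i B <= V)%MS by rewrite (submx_trans (row_sub _ _)) // eq_row_base.
  by have [d d0 Cd] := opC p _ Cp iV; exists d; split=> //; apply: Cd; rewrite gtr0_norm.
exists p, (diag_mx (\row_i d i) *m B); split => //.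
  rewrite -row_leq_rank mxrankMfree ?row_base_free //.
  rewrite row_leq_rank row_free_unit unitmxE det_diag unitfE.
  by apply/prodf_neq0 => i _; rewrite mxE gt_eqF //; case: (dP i).
move=> i; have -> : row i (diag_mx (\row_i d i) *m B) = d i *: row i B.
  by apply/rowP => j; rewrite mul_diag_mx !mxE.
by case: (dP i).
Qed.


Lemma segpt_cross h p q : aeval h p > 0 -> aeval h q < 0 ->
  exists2 t : R, 0 <= t <= 1 & aeval h (segpt t p q) = 0.
Proof.
move=> hp hq; exists (aeval h p / (aeval h p - aeval h q)).
  rewrite divr_ge0 /= ?ler_pdivrMr; lra.
by rewrite aeval_segpt; field; rewrite gt_eqF //; lra.
Qed.

Lemma cut_split h C : C = cut 1 h C `|` cut 0 h C `|` cut (-1) h C.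
Proof.
apply/seteqP; split=> [p Cp|p [[]|] []] //.
by case: (sg_val (aeval h p)); [left; left|left; right|right].
Qed.

Lemma rank_cap_hker (V : 'M[R]_n) h : ~~ (V <= hker h)%MS ->
  (\rank (V :&: hker h)%MS).+1 = \rank V.
Proof.
move=> nVh; apply/eqP; rewrite eqn_leq ltn_neqAle.
rewrite (mxrank_leqif_sup (capmxSl V (hker h))).2 mxrankS ?capmxSl // andbT.
rewrite sub_capmx submx_refl /= nVh /=.
have := mxrank_sum_cap V (hker h); have := mxrank_ker h.1^T.
have := rank_leq_col h.1^T; have := rank_leq_col (V + hker h)%MS.
by rewrite /hker; have := rank_leq_col V; lia.
Qed.

Lemma cut_const h C s : (forall p, C p -> Num.sg (aeval h p) = s) ->
  cut s h C = C /\ forall s', s' != s -> cut s' h C = set0.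
Proof.
move=> sC; split=> [|s' s's]; apply/seteqP; split => // p; first by move=> [].
  by move=> Cp; split=> //=; apply: sC.
by move=> [Cp /= sp]; rewrite -sp sC ?eqxx in s's.
Qed.

(* Either the form has constant sign on C, or it cuts C into two open pieces
   and a slice of codimension one. *)
Lemma tame_cutP V h C : tame V C -> C !=set0 ->
    (exists s, forall p, C p -> Num.sg (aeval h p) = s) \/
    [/\ cut 1 h C !=set0, cut 0 h C !=set0, cut (-1) h C !=set0
      & (\rank (V :&: hker h)%MS).+1 = \rank V].
Proof.
move=> tC [p0 Cp0].
have [Vh|nVh] := boolP (V <= hker h)%MS.
  left; exists (Num.sg (aeval h p0)) => q Cq.
  have := submx_trans (tame_dir tC Cp0 Cq) Vh.
  by rewrite sub_hker dotBr /aeval => /eqP ?; congr Num.sg; lra.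
have [[q [Cq /= q0]]|no0] := pselect (cut 0 h C !=set0).
  right; have /row_subPn[i] := nVh; set v := row i V; rewrite sub_hker => v0.
  have [d d0 Cd] := tame_open tC Cq (row_sub i V).
  move/eqP: q0; rewrite sgr_eq0 => /eqP q0.
  have ns : `|Num.sg (dot h.1 v)| = 1 by rewrite normr_sg v0.
  have step t : `|t| = 1 -> cut t h C !=set0.
    move=> nt; exists (q + (t * d * Num.sg (dot h.1 v)) *: v); split.
      by apply: Cd; rewrite !normrM nt ns mulr1 mul1r gtr0_norm.
    rewrite /= aevalD dotZr q0 add0r -!mulrA -normrEsg !sgrM (gtr0_sg d0).
    have -> : Num.sg `|dot h.1 v| = 1 by rewrite gtr0_sg ?normr_gt0.
    rewrite !mulr1.
    by move/eqP: nt; rewrite eqr_norml ler01 andbT => /orP[]/eqP->; rewrite ?sgrN sgr1.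
  split; last exact: rank_cap_hker.
  - by apply: step; rewrite normr1.
  - by exists q; split=> //=; rewrite q0 sgr0.
  - by apply: step; rewrite normrN1.
(* If the form has no zero on C, two points of opposite signs are impossible, as the segment between
   them would contain one. *)
left; exists (Num.sg (aeval h p0)) => q Cq.
have n0 p : C p -> aeval h p != 0.
  by move=> Cp; apply/eqP => p0'; apply: no0; exists p; split=> //=; rewrite p0' sgr0.
have cross p p' : C p -> C p' -> 0 < aeval h p -> aeval h p' < 0 -> False.
  move=> Cp Cp' hp hp'; have [t t01 ht] := segpt_cross hp hp'.
  by have := n0 _ (tame_convex tC Cp Cp' t01); rewrite ht eqxx.
have := n0 _ Cp0; have := n0 _ Cq; rewrite !neq_lt => /orP[hq|hq] /orP[hp|hp].
- by rewrite !ltr0_sg.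
- by have := cross _ _ Cp0 Cq hp hq.
- by have := cross _ _ Cq Cp0 hq hp.
- by rewrite !gtr0_sg.
Qed.

(** * Signed dimensions under a cut *)

Definition sgdim C : int := if C == set0 then 0 else (-1) ^+ affdim C.

(** Bounds the coordinates one by one; [bnd_bounded] identifies this with boundedness in norm. *)
Definition bnd C := exists M : R, forall p, C p -> forall j, `|p ord0 j| <= M.

Definition bnd_sgdim C : int := if `[< bnd C >] then sgdim C else 0.

Definition cut_additive (f : set pt -> int) h C :=
  f (cut 1 h C) + f (cut 0 h C) + f (cut (-1) h C) = f C.

(** The value at the empty set is imposed: its [affdim], a maximum over no index, is 0 and would
    count it as a point. *)
Lemma sgdim0 : sgdim set0 = 0.
Proof. by rewrite /sgdim eqxx. Qed.

Lemma bnd_sgdim0 : bnd_sgdim set0 = 0.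
Proof. by rewrite /bnd_sgdim sgdim0 if_same. Qed.

Lemma sgdim_tame V C : tame V C -> C !=set0 -> sgdim C = (-1) ^+ \rank V.
Proof.
move=> tC C0; rewrite /sgdim (affdim_tame tC C0).
by case: eqP => // E; case: C0 => p; rewrite E.
Qed.

Lemma cut_additive_const f h C s : f set0 = 0 -> C !=set0 ->
  (forall p, C p -> Num.sg (aeval h p) = s) -> cut_additive f h C.
Proof.
move=> f0 [p Cp] sC; have [E E0] := cut_const sC; rewrite /cut_additive.
have one0 : (1 : R) != 0 by rewrite oner_eq0.
have n1 : (-1 : R) != 1 by rewrite lt_eqF //; lra.
have n10 : (-1 : R) != 0 by rewrite oppr_eq0.
case: (sg_val (aeval h p)); rewrite sC // => sE; rewrite -sE E sE in E0 *.
- by rewrite (E0 0) ?(E0 (-1)) ?f0 ?addr0 // eq_sym.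
- by rewrite (E0 1) ?(E0 (-1)) ?f0 ?addr0 ?add0r // eq_sym.
- by rewrite (E0 0) ?(E0 1) ?f0 ?addr0 ?add0r // eq_sym.
Qed.

Lemma cut_set0 s h : cut s h set0 = set0.
Proof. by rewrite /cut set0I. Qed.

Lemma sgdim_cut h C : is_tame C -> cut_additive sgdim h C.
Proof.
move=> [V tC]; have [->|/set0P C0] := eqVneq C set0.
  by rewrite /cut_additive !cut_set0 sgdim0.
have [[s sC]|[p1 p0 pm rk]] := tame_cutP h tC C0.
  exact: cut_additive_const sgdim0 C0 sC.
rewrite /cut_additive (sgdim_tame (tame_cut0 h tC)) // (sgdim_tame tC) //.
rewrite !(sgdim_tame (tame_cut_open _ _ tC)) ?oppr_eq0 ?oner_eq0 //.
by rewrite -rk exprS; lia.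
Qed.

(* A function such as the sum of the absolute values of coercive forms of
   constant sign on C. *)
Record controlled C (g : pt -> R) : Prop := Controlled {
  ctl_aff : forall p q (t : R), C p -> C q -> 0 <= t <= 1 ->
    g (segpt t p q) = (1 - t) * g p + t * g q;
  ctl_ge0 : forall p, C p -> 0 <= g p;
  ctl_bnd : forall D, D `<=` C -> (bnd D <-> exists M, forall p, D p -> g p <= M)
}.

Lemma controlled_sub C D g : D `<=` C -> controlled C g -> controlled D g.
Proof.
move=> DC [gaff g0 gb]; split=> [p q t Dp Dq|p Dp|D' D'D].
- by apply: gaff; apply: DC.
- by apply: g0; apply: DC.
- by apply: gb; apply: subset_trans DC.
Qed.

Lemma bnd_sub C D : D `<=` C -> bnd C -> bnd D.
Proof. by move=> DC [M CM]; exists M => p /DC/CM. Qed.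

Lemma bnd_setU C D : bnd C -> bnd D -> bnd (C `|` D).
Proof.
move=> [M CM] [M' DM']; exists (Num.max M M') => p [/CM|/DM'] pM j.
  by rewrite le_max pM.
by rewrite le_max pM orbT.
Qed.

(* If an unbounded C has a bounded slice, then exactly one of the two sides is
   bounded, and it cancels against the slice. *)
Lemma bnd_sgdim_cut h C g : is_tame C -> controlled C g -> cut_additive bnd_sgdim h C.
Proof.
move=> [V tC] cg; have [->|/set0P C0] := eqVneq C set0.
  by rewrite /cut_additive !cut_set0 bnd_sgdim0.
have [[s sC]|[p1 p0 pm rk]] := tame_cutP h tC C0.
  exact: cut_additive_const bnd_sgdim0 C0 sC.
have [bC|nbC] := pselect (bnd C).
  have bs s : bnd (cut s h C) by apply: bnd_sub bC; apply: cut_sub.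
  by rewrite /cut_additive /bnd_sgdim !asboolT //; apply: sgdim_cut; exists V.
(* A bounded side bounds the slice: the midpoint of a fixed q in the side and a point p of the slice
   lies in that side, so [g p] is at most 2M. *)
have unb0 s : s != 0 -> cut s h C !=set0 -> bnd (cut s h C) -> bnd (cut 0 h C).
  move=> s0 [q [Cq /= sq]] /(ctl_bnd cg (@cut_sub s h C))[M gM].
  apply/(ctl_bnd cg (@cut_sub 0 h C)); exists (2 * M) => p [Cp /= sp].
  have h2 : 0 <= (2^-1 : R) <= 1 by lra.
  have := gM (segpt 2^-1 q p); rewrite (ctl_aff cg Cq Cp h2).
  have := ctl_ge0 cg Cq; suff cq : cut s h C (segpt 2^-1 q p) by move=> ? /(_ cq); lra.
  split; first exact: tame_convex tC _ _ _ Cq Cp h2.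
  move/eqP: sp; rewrite /= aeval_segpt sgr_eq0 => /eqP ->.
  by rewrite mulr0 addr0 sgrM sq gtr0_sg ?mul1r //; lra.
have [b0|nb0] := pselect (bnd (cut 0 h C)); last first.
  rewrite /cut_additive /bnd_sgdim !asboolF ?addr0 // => bs; apply: nb0.
    by apply: unb0 bs => //; rewrite oppr_eq0 oner_eq0.
  by apply: unb0 bs => //; rewrite oner_eq0.
(* If both sides were unbounded, a segment between points with g above M on either side would meet
   the slice, where g is at most M, although g is affine on the segment. *)
have some : bnd (cut 1 h C) \/ bnd (cut (-1) h C).
  apply: contrapT => /not_orP[n1 nm].
  have [M gM] := (ctl_bnd cg (@cut_sub 0 h C)).1 b0.
  have big s : ~ bnd (cut s h C) -> exists2 p, cut s h C p & M < g p.
    move=> nb; apply: contrapT => no; apply: nb.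
    apply/(ctl_bnd cg (@cut_sub s h C)); exists M => p cp; rewrite leNgt.
    by apply/negP => gp; apply: no; exists p.
  have [p [Cp /= sp] gp] := big _ n1; have [q [Cq /= sq] gq] := big _ nm.
  have hp : 0 < aeval h p by rewrite -sgr_gt0 sp.
  have hq : aeval h q < 0 by rewrite -sgr_lt0 sq; lra.
  have [t t01 ht] := segpt_cross hp hq.
  have := gM (segpt t p q); rewrite (ctl_aff cg Cp Cq t01) => /(_ _)/wrap[].
    by split; [exact: tame_convex tC _ _ _ Cp Cq t01|rewrite /= ht sgr0].
  case/andP: t01; rewrite le_eqVlt => /orP[/eqP <-|t0] t1; first by lra.
  have : 0 < t * (g q - M) by rewrite mulr_gt0 // subr_gt0.
  have : 0 <= (1 - t) * (g p - M) by rewrite mulr_ge0 // subr_ge0 // ltW.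
  by lra.
have notboth : ~ (bnd (cut 1 h C) /\ bnd (cut (-1) h C)).
  by move=> [b1 bm]; apply: nbC; rewrite (cut_split h C); do 2?apply: bnd_setU.
have s1 : sgdim (cut 1 h C) + sgdim (cut 0 h C) = 0.
  rewrite (sgdim_tame (tame_cut0 h tC)) // (sgdim_tame (tame_cut_open _ _ tC)) ?oner_eq0 //.
  by rewrite -rk exprS; lia.
have sm : sgdim (cut 0 h C) + sgdim (cut (-1) h C) = 0.
  rewrite (sgdim_tame (tame_cut0 h tC)) // (sgdim_tame (tame_cut_open _ _ tC)) ?oppr_eq0 ?oner_eq0 //.
  by rewrite -rk exprS; lia.
rewrite /cut_additive /bnd_sgdim (asboolT b0) (asboolF nbC).
case: some => b; rewrite (asboolT b).
  by rewrite asboolF ?s1 ?addr0 // => bm; apply: notboth.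
by rewrite asboolF ?add0r // => b1; apply: notboth.
Qed.

(** * Iterated cuts by a list of forms *)

Fixpoint leaves C L : seq (set pt) :=
  if L is h :: L' then
    leaves (cut 1 h C) L' ++ leaves (cut 0 h C) L' ++ leaves (cut (-1) h C) L'
  else [:: C].

Definition lsum (f : set pt -> int) C L := \sum_(G <- leaves C L) f G.

Lemma lsum_cons f C h L : lsum f C (h :: L) =
  lsum f (cut 1 h C) L + lsum f (cut 0 h C) L + lsum f (cut (-1) h C) L.
Proof. by rewrite /lsum /= !big_cat /= addrA. Qed.

Lemma lsum_additive (Pr : set pt -> Prop) f C L :
  (forall C h s, Pr C -> Pr (cut s h C)) ->
  (forall C h, Pr C -> cut_additive f h C) -> Pr C -> lsum f C L = f C.
Proof.
move=> Prc fc; elim: L C => [|h L IH] C PC; first by rewrite /lsum big_seq1.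
by rewrite lsum_cons !IH; [apply: fc|apply: Prc..].
Qed.

Lemma lsum_cat f C L1 L2 :
  lsum f C (L1 ++ L2) = \sum_(G <- leaves C L1) lsum f G L2.
Proof.
elim: L1 C => [|h L1 IH] C; first by rewrite big_seq1.
by rewrite cat_cons lsum_cons !IH /= !big_cat /= addrA.
Qed.

Lemma cutC s h s' h' C : cut s h (cut s' h' C) = cut s' h' (cut s h C).
Proof. by rewrite /cut setIAC. Qed.

Lemma lsum_middle f C L1 h L2 : lsum f C (L1 ++ h :: L2) = lsum f C (h :: L1 ++ L2).
Proof.
elim: L1 C => // k L1 IH C; rewrite cat_cons lsum_cons !IH !lsum_cons.
rewrite !(cutC _ h _ k).
by rewrite [LHS](AC (3*3*3) ((1*4*7)*(2*5*8)*(3*6*9))%AC).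
Qed.

(** The order of the cuts is immaterial, so two families of forms can be compared through their
    common refinement. *)
Lemma lsum_catC f C L1 L2 : lsum f C (L1 ++ L2) = lsum f C (L2 ++ L1).
Proof.
elim: L2 C => [|h L2 IH] C; first by rewrite cats0.
by rewrite lsum_middle cat_cons !lsum_cons !IH.
Qed.

Definition samesign L p q := forall h, h \in L -> Num.sg (aeval h q) = Num.sg (aeval h p).

Definition sgcell C L p : set pt := C `&` [set q | samesign L p q].

Lemma samesign_cons h L p q :
  samesign (h :: L) p q <-> Num.sg (aeval h q) = Num.sg (aeval h p) /\ samesign L p q.
Proof.
split=> [s|[sh sL] k]; last by rewrite inE => /orP[/eqP->|/sL].
by split=> [|k kL]; apply: s; rewrite inE ?eqxx ?kL ?orbT.
Qed.

Lemma sgcell_cons C h L p :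
  sgcell C (h :: L) p = sgcell (cut (Num.sg (aeval h p)) h C) L p.
Proof.
apply/seteqP; split=> q.
  by move=> [Cq /samesign_cons[? ?]]; split.
by move=> [[Cq ?] ?]; split=> //; apply/samesign_cons.
Qed.

Lemma mem_leaves C L p : C p -> sgcell C L p \in leaves C L.
Proof.
elim: L C => [|h L IH] C Cp /=.
  rewrite inE; by apply/eqP/seteqP; split=> [q []|q Cq].
have Cp' : cut (Num.sg (aeval h p)) h C p by [].
rewrite sgcell_cons !mem_cat; have := IH _ Cp'.
by case: (sg_val (aeval h p)) => -> ->; rewrite ?orbT.
Qed.

Lemma leaves_sub C L G : G \in leaves C L -> G `<=` C.
Proof.
elim: L C => [|h L IH] C /=; first by rewrite inE => /eqP->.
by rewrite !mem_cat => /or3P[] /IH GC; apply: subset_trans GC (@cut_sub _ _ _).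
Qed.

Lemma leavesE C L G p : G \in leaves C L -> G p -> G = sgcell C L p.
Proof.
elim: L C => [|h L IH] C /=.
  rewrite inE => /eqP-> Cp; by apply/seteqP; split=> [q Cq|q []].
rewrite sgcell_cons !mem_cat => /or3P[] Gl Gp; have := leaves_sub Gl Gp => -[_ /= ->];
  exact: IH.
Qed.

(** Pieces on different sides of a form are disjoint, so only the empty set can occur twice. *)
Lemma uniq_leaves C L : uniq [seq G <- leaves C L | G != set0].
Proof.
elim: L C => [|h L IH] C /=; first by case: ifP.
have dj s s' G : s != s' -> G \in [seq G <- leaves (cut s h C) L | G != set0] ->
    G \notin [seq G <- leaves (cut s' h C) L | G != set0].
  move=> ss'; rewrite !mem_filter => /andP[/set0P[p Gp] Gs]; apply/negP => /andP[_ Gs'].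
  have [_ /= E] := leaves_sub Gs Gp; have [_ /= E'] := leaves_sub Gs' Gp.
  by rewrite -E -E' eqxx in ss'.
have n1 : (-1 : R) != 1 by rewrite lt_eqF //; lra.
have n10 : (-1 : R) != 0 by rewrite oppr_eq0 oner_eq0.
rewrite !filter_cat !cat_uniq !IH /= has_cat negb_or andbT.
rewrite -!andbA; apply/and3P; split; apply/hasPn => G /=; apply: dj => //.
by rewrite eq_sym oner_eq0.
Qed.

Lemma lsum_filter (f : set pt -> int) C L : f set0 = 0 ->
  lsum f C L = \sum_(G <- [seq G <- leaves C L | G != set0]) f G.
Proof.
move=> f0; rewrite big_filter big_mkcond /lsum; apply: eq_bigr => G _.
by case: eqP => [->|].
Qed.

(** * Coercive families and bounded cells *)

Definition coercive L := exists K : R, forall p j,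
  `|p ord0 j| <= K + K * \sum_(h <- L) `|aeval h p|.

Lemma norm_segpt (x y t : R) : Num.sg x = Num.sg y -> 0 <= t <= 1 ->
  `|(1 - t) * x + t * y| = (1 - t) * `|x| + t * `|y|.
Proof.
move=> sxy /andP[t0 t1].
have [x0|x0|x0] := ltrgtP x 0; move: sxy.
- rewrite (ltr0_sg x0) => /esym/eqP; rewrite sgr_cp0 => y0.
  by rewrite (ltr0_norm x0) (ltr0_norm y0) ler0_norm; nra.
- rewrite (gtr0_sg x0) => /esym/eqP; rewrite sgr_cp0 => y0.
  by rewrite (gtr0_norm x0) (gtr0_norm y0) ger0_norm; nra.
- rewrite x0 sgr0 => /esym/eqP; rewrite sgr_eq0 => /eqP ->.
  by rewrite !mulr0 addr0 normr0 !mulr0 addr0.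
Qed.

Lemma dot_le_bound u p (M : R) : (forall j, `|p ord0 j| <= M) ->
  `|dot u p| <= (\sum_j `|u ord0 j|) * M.
Proof.
move=> pM; rewrite mulr_suml; apply: le_trans (ler_norm_sum _ _ _) _.
by apply: ler_sum => j _; rewrite normrM ler_wpM2l.
Qed.

(** The forms keep their signs on a leaf, so the sum of their absolute values is affine there.
    Coercivity makes it bound the coordinates, and bounded coordinates always bound it. *)
Lemma leaf_controlled C L G : coercive L -> G \in leaves C L ->
  controlled G (fun p => \sum_(h <- L) `|aeval h p|).
Proof.
move=> [K LK] GL; split.
- move=> p q t Gp Gq t01; rewrite !mulr_sumr -big_split /= big_seq [RHS]big_seq.
  apply: eq_bigr => h hL; rewrite aeval_segpt norm_segpt //.
  by move: Gq; rewrite (leavesE GL Gp) => -[_ /(_ _ hL)].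
- by move=> p _; apply: sumr_ge0.
move=> D DG; split=> -[M DM].
  exists (\sum_(h <- L) ((\sum_j `|h.1 ord0 j|) * M + `|h.2|)) => p Dp.
  apply: ler_sum => h _; apply: le_trans (ler_normB _ _) _.
  by rewrite lerD2r; apply: dot_le_bound; apply: DM.
exists (`|K| + `|K| * M) => p Dp j; apply: le_trans (LK p j) _.
have s0 : 0 <= \sum_(h <- L) `|aeval h p| by apply: sumr_ge0.
rewrite lerD ?ler_norm //; apply: le_trans (ler_wpM2r s0 (ler_norm K)) _.
by rewrite ler_wpM2l // DM.
Qed.

Lemma is_tame_leaf C L G : is_tame C -> G \in leaves C L -> is_tame G.
Proof.
elim: L C => [|h L IH] C tC /=; first by rewrite inE => /eqP->.
by rewrite !mem_cat => /or3P[]; apply: IH; apply: is_tame_cut.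
Qed.

Lemma lsum_sgdim C L : is_tame C -> lsum sgdim C L = sgdim C.
Proof.
apply: lsum_additive => [D h s|D h]; [exact: is_tame_cut|exact: sgdim_cut].
Qed.

(** After the cuts by [L1] every piece is controlled and stays so, hence the further cuts by [L2]
    preserve the sum. *)
Lemma lsum_bnd_sgdim_cat C L1 L2 : is_tame C -> coercive L1 ->
  lsum bnd_sgdim C (L1 ++ L2) = lsum bnd_sgdim C L1.
Proof.
move=> tC cL; rewrite lsum_cat /lsum big_seq [RHS]big_seq; apply: eq_bigr => G GL.
pose Pr D := is_tame D /\ exists g, controlled D g.
apply: (@lsum_additive Pr).
- move=> D h s [tD [g Dg]]; split; first exact: is_tame_cut.
  by exists g; apply: controlled_sub Dg; apply: cut_sub.
- by move=> D h [tD [g Dg]]; apply: bnd_sgdim_cut tD Dg.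
- split; first exact: is_tame_leaf GL.
  by eexists; apply: leaf_controlled GL.
Qed.

Definition coord_forms p : seq aform := [seq (delta_mx ord0 j, p ord0 j) | j <- enum 'I_n].

Lemma aeval_coord p q j : aeval (delta_mx ord0 j, p ord0 j) q = q ord0 j - p ord0 j.
Proof.
rewrite /aeval /dot (bigD1 j) //= big1 ?addr0 => [|k kj].
  by rewrite mxE !eqxx mul1r.
by rewrite mxE eqxx (negPf kj) mul0r.
Qed.

Lemma coercive_coord p : coercive (coord_forms p).
Proof.
exists (1 + \sum_j `|p ord0 j|) => q j.
have pj : `|p ord0 j| <= \sum_j `|p ord0 j|.
  by rewrite (bigD1 j) //= lerDl sumr_ge0.
have qj : `|q ord0 j - p ord0 j| <= \sum_(h <- coord_forms p) `|aeval h q|.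
  rewrite big_map big_enum (bigD1 j) //= aeval_coord lerDl; apply: sumr_ge0 => k _.
  exact: normr_ge0.
have := ler_normD (q ord0 j - p ord0 j) (p ord0 j); rewrite subrK.
have := normr_ge0 (p ord0 j); have := normr_ge0 (q ord0 j - p ord0 j); nra.
Qed.

Lemma bnd_sgdim_singleton p : bnd_sgdim [set p] = 1.
Proof.
have t1 : tame 0 [set p].
  split=> [q r -> ->|q v -> |q r t -> -> _].
  - by rewrite subrr sub0mx.
  - rewrite submx0 => /eqP ->; exists 1; first exact: ltr01.
    by move=> t _; rewrite scaler0 addr0.
  - by rewrite /segpt subrr scaler0 addr0.
have b1 : bnd [set p].
  exists (\sum_j `|p ord0 j|) => q -> j.
  by rewrite (bigD1 j) //= lerDl sumr_ge0.
rewrite /bnd_sgdim asboolT // (sgdim_tame t1) ?mxrank0 //.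
by exists p.
Qed.

(** A piece containing some q other than p contains the whole open ray from p through q, so
    [[set p]] is the only bounded nonempty piece. *)
Lemma lsum_bnd_sgdim_coord C p : C p ->
    (forall q t, C q -> 0 < t -> C (p + t *: (q - p))) ->
  lsum bnd_sgdim C (coord_forms p) = 1.
Proof.
move=> Cp cone; rewrite lsum_filter ?bnd_sgdim0 //.
have cellp : sgcell C (coord_forms p) p = [set p].
  apply/seteqP; split=> [q [Cq sq]|q ->]; last by split.
  apply/rowP => j; have := sq (delta_mx ord0 j, p ord0 j).
  rewrite !aeval_coord subrr sgr0 => /(_ _)/wrap[]; first by apply: map_f; rewrite mem_enum.
  by move/eqP; rewrite sgr_eq0 subr_eq0 => /eqP.
rewrite (bigD1_seq [set p]) ?uniq_leaves //=; last first.
  rewrite mem_filter -cellp mem_leaves // andbT; apply/set0P; exists p.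
  by split.
rewrite bnd_sgdim_singleton big1_seq ?addr0 // => G /andP[Gp].
rewrite mem_filter => /andP[/set0P[q Gq] GL]; rewrite /bnd_sgdim asboolF //.
have GE := leavesE GL Gq.
have qp : q != p by apply: contraNneq Gp => qp; rewrite GE qp cellp.
have [j qj] : exists j, q ord0 j != p ord0 j.
  by apply/existsP; apply: contraNT qp => /existsPn qp; apply/eqP/rowP => j; apply/eqP/negPn.
have Cq : C q := leaves_sub GL Gq.
move=> [M GM].
pose x := `|q ord0 j - p ord0 j|; have x0 : 0 < x by rewrite normr_gt0 subr_eq0.
(* With this t the j-th coordinate moves by 1 + |M| + |p_j| away from p_j, hence exceeds M in
   absolute value. *)
pose t := (1 + `|M| + `|p ord0 j|) / x.
have t0 : 0 < t by rewrite divr_gt0 // ltr_wpDr // ltr_wpDr.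
have Gt : G (p + t *: (q - p)).
  rewrite GE; split; first exact: cone.
  move=> _ /mapP[k _ ->]; rewrite !aeval_coord !mxE addrAC subrr add0r.
  by rewrite sgrM gtr0_sg // mul1r.
have := GM _ Gt j; rewrite !mxE.
have := ler_normB (p ord0 j + t * (q ord0 j - p ord0 j)) (p ord0 j).
rewrite addrAC subrr add0r normrM gtr0_norm // -/x /t divfK ?gt_eqF //.
have := ler_norm M; lra.
Qed.

(** Both [L] and the coordinate forms through p are coercive, so each gives the same sum as their
    common refinement. *)
Lemma lsum_bnd_sgdim_cone C L p : is_tame C -> coercive L -> C p ->
    (forall q t, C q -> 0 < t -> C (p + t *: (q - p))) ->
  lsum bnd_sgdim C L = 1.
Proof.
move=> tC cL Cp cone; rewrite -(lsum_bnd_sgdim_coord Cp cone).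
by rewrite -(lsum_bnd_sgdim_cat (coord_forms p) tC cL) lsum_catC lsum_bnd_sgdim_cat //; apply: coercive_coord.
Qed.

End Cells.

(** * Faces and flats of an arrangement *)

Lemma sgr_eqP (R : realType) (x y : R) :
  (0 < x) = (0 < y) -> (x < 0) = (y < 0) -> Num.sg x = Num.sg y.
Proof.
have [x0|x0|->] := ltrgtP x 0; have [y0|y0|->] := ltrgtP y 0 => // _ _.
- by rewrite !ltr0_sg.
- by rewrite !gtr0_sg.
Qed.

Lemma norm_entry_le (R : realType) (n : nat) (p : 'rV[R]_n) j : `|p ord0 j| <= `|p|.
Proof.
rewrite [leRHS]/Num.Def.normr /= mx_normrE.
by apply/bigmax_geP; right; exists (ord0, j).
Qed.

Lemma norm_row_le (R : realType) (n : nat) (p : 'rV[R]_n) (M : R) :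
  0 <= M -> (forall j, `|p ord0 j| <= M) -> `|p| <= M.
Proof.
move=> M0 pM; rewrite [leLHS]/Num.Def.normr /= mx_normrE.
by apply: bigmax_le => // -[i j] _ /=; rewrite ord1.
Qed.

Lemma bnd_bounded (R : realType) (n : nat) (F : set 'rV[R]_n) : bounded_set F <-> bnd F.
Proof.
split=> [[M [_ FM]]|[M FM]].
  exists (M + 1) => p Fp j; have := FM (M + 1); rewrite ltrDl ltr01 => /(_ isT _ Fp) /=.
  exact: le_trans (norm_entry_le _ _).
exists `|M|; split=> [|K MK p Fp /=]; first exact: num_real.
apply: norm_row_le => [|j]; first by rewrite (le_trans _ (ltW MK)).
by apply: le_trans (FM _ Fp j) _; apply: le_trans (ler_norm M) (ltW MK).
Qed.

Section Arr.
Variables (R : realType) (n m : nat) (H : 'I_m -> hyperplane R n).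
Local Notation pt := 'rV[R]_n.
Implicit Types (p q : pt) (S T : {set 'I_m}).

Definition af i : pt * R := (hp_normal (H i), hp_offset (H i)).
Definition arr_forms := [seq af i | i <- enum 'I_m].

Definition sgn i p := Num.sg (hp_form (H i) p).

Definition Cell p : set pt := [set q | forall i, sgn i q = sgn i p].

Lemma Cell_refl p : Cell p p. Proof. by []. Qed.

Lemma Cell_eq p q : Cell p q -> Cell q = Cell p.
Proof.
by move=> pq; apply/seteqP; split=> r rE i; rewrite rE pq.
Qed.

Lemma sgcell_arr C p : (forall q, C q -> Cell q `<=` C) -> C p ->
  sgcell C arr_forms p = Cell p.
Proof.
move=> sat Cp; apply/seteqP; split=> [q [_ sq] i|q pq].
  by apply: (sq (af i)); apply: map_f; rewrite mem_enum.
split; first exact: sat pq.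
by move=> _ /mapP[i _ ->]; apply: pq.
Qed.

Lemma facesP F : reflect (exists p, F = Cell p) (F \in faces H).
Proof.
have cellE A p : cell H A p -> cell H A = Cell p.
  move=> pA; apply/seteqP; split=> q qA i.
    by have [p1 p2] := pA i; have [q1 q2] := qA i; apply: sgr_eqP; rewrite ?q1 ?q2.
  have [<- <-] := pA i; have := qA i; rewrite /sgn => E.
  by split; [rewrite -sgr_gt0 E sgr_gt0|rewrite -sgr_lt0 E sgr_lt0].
apply: (iffP idP) => [/imfsetP[A]|[p ->]].
  rewrite inE => Ac ->; have /set0P[p pA] : cell H A != set0 by case/andP: Ac.
  by exists p; apply: cellE.
have pA : cell H ([set i | 0 < hp_form (H i) p], [set i | hp_form (H i) p < 0])%SET p.
  by move=> i; rewrite !inE.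
apply/imfsetP; exists ([set i | 0 < hp_form (H i) p], [set i | hp_form (H i) p < 0])%SET.
  by rewrite inE; apply/andP; split=> //; apply/set0P; exists p.
by rewrite (cellE _ p).
Qed.

(** The direction space of the flat of S. Columns outside S are zeroed, so that the matrix has the
    same size for all S. *)
Definition dirs S : 'M[R]_n :=
  kermx (\matrix_(j < n, i < m) (if i \in S then hp_normal (H i) ord0 j else 0)).

Lemma sub_dirs S (v : pt) :
  (v <= dirs S)%MS <-> forall i, i \in S -> dot (hp_normal (H i)) v = 0.
Proof.
split=> [/sub_kermxP/rowP E i iS|E].
  move: (E i); rewrite !mxE => <-; apply: eq_bigr => j _.
  by rewrite mxE iS mulrC.
apply/sub_kermxP/rowP => i; rewrite !mxE; case: (boolP (i \in S)) => iS.
  by apply: etrans (E i iS); apply: eq_bigr => j _; rewrite mxE iS mulrC.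
by apply: big1 => j _; rewrite mxE (negPf iS) mulr0.
Qed.

Lemma flatP S p : flat H S p <-> forall i, i \in S -> hp_form (H i) p = 0.
Proof. by split=> pS i; apply: pS. Qed.

Lemma hp_formE i p : hp_form (H i) p = aeval (af i) p. Proof. by []. Qed.

Lemma flat_add S p v : flat H S p -> (v <= dirs S)%MS -> flat H S (p + v).
Proof.
move=> /flatP pS /sub_dirs vS; apply/flatP => i iS.
by rewrite hp_formE aevalD -hp_formE pS // vS // addr0.
Qed.

Lemma flat_sub S p q : flat H S p -> flat H S q -> (q - p <= dirs S)%MS.
Proof.
move=> /flatP pS /flatP qS; apply/sub_dirs => i iS; rewrite dotBr.
have := pS i iS; have := qS i iS; rewrite !hp_formE /aeval /=; lra.
Qed.

Lemma tame_flat S : tame (dirs S) (flat H S).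
Proof.
split=> [p q|p v pS vS|p q t pS qS _]; first exact: flat_sub.
  by exists 1; [exact: ltr01|move=> t _; apply: flat_add => //; apply: scalemx_sub].
by apply: flat_add => //; apply/scalemx_sub/flat_sub.
Qed.

Lemma tame_signs V C (s : 'I_m -> R) (r : seq 'I_m) :
    (forall i, i \in r -> s i != 0) -> tame V C ->
  tame V (C `&` [set q | forall i, i \in r -> sgn i q = s i]).
Proof.
move=> s0 tC; elim: r s0 => [|i r IH] s0.
  by have -> : [set q | forall i, i \in [::] -> sgn i q = s i] = setT;
    [apply/seteqP; split|rewrite setIT].
have -> : C `&` [set q | forall j, j \in i :: r -> sgn j q = s j] =
          cut (s i) (af i) (C `&` [set q | forall j, j \in r -> sgn j q = s j]).
  apply/seteqP; split=> q.
    move=> [Cq sq]; split; last by apply: sq; rewrite inE eqxx.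
    by split=> // j jr; apply: sq; rewrite inE jr orbT.
  by move=> [[Cq sq] si]; split=> // j; rewrite inE => /orP[/eqP->|/sq].
apply: tame_cut_open; first by apply: s0; rewrite inE eqxx.
by apply: IH => j jr; apply: s0; rewrite inE jr orbT.
Qed.

(** * Stars and dimensions of faces *)

Definition zeros p : {set 'I_m} := [set i | hp_form (H i) p == 0]%SET.

Lemma in_zeros i p : (i \in zeros p) = (sgn i p == 0).
Proof. by rewrite inE sgr_eq0. Qed.

(** For p in the flat, the open star of its face there: the union of the faces in the flat whose
    closure contains [Cell p]. *)
Definition star S p : set pt :=
  flat H S `&` [set q | forall i, sgn i p != 0 -> sgn i q = sgn i p].

Lemma tame_star S p : tame (dirs S) (star S p).
Proof.
have -> : star S p =
    flat H S `&` [set q | forall i, i \in enum (~: zeros p)%SET -> sgn i q = sgn i p].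
  congr (_ `&` _); apply/seteqP; split=> q sq i.
    by rewrite mem_enum inE in_zeros; apply: sq.
  by move=> i0; apply: sq; rewrite mem_enum inE in_zeros.
apply: tame_signs (tame_flat S) => i.
by rewrite mem_enum inE in_zeros.
Qed.

Lemma Cell_star p : Cell p = star (zeros p) p.
Proof.
apply/seteqP; split=> q.
  move=> qp; split; last by move=> i _; apply: qp.
  apply/flatP => i; rewrite in_zeros => /eqP p0; apply/eqP.
  by rewrite -sgr_eq0 -[Num.sg _]/(sgn i q) qp p0.
move=> [/flatP q0 qs] i; have [p0|/qs//] := eqVneq (sgn i p) 0.
by rewrite p0 /sgn q0 ?sgr0 // in_zeros p0.
Qed.

Lemma star_refl S p : flat H S p -> star S p p. Proof. by []. Qed.

Lemma flat_zeros p : flat H (zeros p) p.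
Proof. by apply/flatP => i; rewrite inE => /eqP. Qed.

Lemma affdim_flat S p : flat H S p -> affdim (flat H S) = \rank (dirs S).
Proof. by move=> Sp; apply: affdim_tame (tame_flat S) _; exists p. Qed.

Lemma affdim_Cell p : affdim (Cell p) = affdim (flat H (zeros p)).
Proof.
rewrite (affdim_flat (@flat_zeros p)) Cell_star.
by apply: affdim_tame (tame_star _ _) _; exists p; apply/star_refl/flat_zeros.
Qed.

Lemma affdim_flat_lt S T p : flat H T p -> flat H T `<=` flat H S ->
  flat H T != flat H S -> (affdim (flat H T) < affdim (flat H S))%N.
Proof.
move=> Tp TS neq; have Sp := TS _ Tp.
have dTS : (dirs T <= dirs S)%MS.
  apply/row_subP => i; have := flat_sub Sp (TS _ (flat_add Tp (row_sub i (dirs T)))).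
  by rewrite addrC addKr.
rewrite (affdim_flat Tp) (affdim_flat Sp) ltn_neqAle (mxrank_leqif_sup dTS).2 mxrankS // andbT.
apply: contra neq => dST; apply/eqP/seteqP; split=> // q Sq.
have := flat_add Tp (submx_trans (flat_sub Sp Sq) dST).
by rewrite addrC subrK.
Qed.

(** The matrix of normals has a left inverse B, which recovers every coordinate of p from the values
    of the forms. *)
Lemma essential_coercive : essential H -> coercive arr_forms.
Proof.
move=> /row_fullP[B BA].
have pE p j : p ord0 j = \sum_i B j i * (hp_form (H i) p + hp_offset (H i)).
  have := congr1 (fun M => (M *m p^T) j ord0) BA; rewrite mul1mx -mulmxA !mxE => <-.
  apply: eq_bigr => i _; rewrite !mxE /hp_form subrK; congr (_ * _).
  by apply: eq_bigr => k _; rewrite !mxE.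
exists (\sum_j \sum_i `|B j i| * (1 + `|hp_offset (H i)|)) => p j.
set K := \sum_j _.
have Kj : \sum_i `|B j i| * (1 + `|hp_offset (H i)|) <= K.
  by rewrite /K (bigD1 j) //= lerDl; apply: sumr_ge0 => k _; apply: sumr_ge0 => i _; rewrite mulr_ge0 // addr_ge0.
rewrite big_map big_enum /= mulr_sumr {1}pE; apply: le_trans (ler_norm_sum _ _ _) _.
apply: (@le_trans _ _ (\sum_i (`|B j i| * (1 + `|hp_offset (H i)|) + K * `|hp_form (H i) p|))); last first.
  by rewrite big_split lerD2r.
apply: ler_sum => i _; rewrite normrM.
have BK : `|B j i| <= K.
  apply: le_trans Kj; rewrite (bigD1 i) //=.
  rewrite -[leLHS]mulr1 -[leLHS]addr0 lerD //; first by rewrite ler_wpM2l // lerDl.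
  by apply: sumr_ge0 => k _; rewrite mulr_ge0 // addr_ge0.
have := ler_normD (hp_form (H i) p) (hp_offset (H i)).
have := normr_ge0 (hp_form (H i) p); have := normr_ge0 (B j i); nra.
Qed.

(** A form that is nonzero at p keeps its sign near p; conversely, a small step from a point of
    [Cell p] towards q enters [Cell q]. *)
Lemma closure_CellP p q :
  Cell p `<=` closure (Cell q) <-> forall i, sgn i p != 0 -> sgn i q = sgn i p.
Proof.
split=> [sub i p0|le p' pp' B].
  have f0 : 0 < `|hp_form (H i) p| by rewrite normr_gt0 -sgr_eq0.
  (* Since s exceeds the sum of the absolute entries of the normal, a point closer to p than
     |[hp_form (H i) p]| / s has the same sign. *)
  pose s := 1 + \sum_j `|hp_normal (H i) ord0 j|.
  have s0 : 0 < s by rewrite ltr_wpDr // sumr_ge0.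
  have e0 : 0 < `|hp_form (H i) p| / s by rewrite divr_gt0.
  have [r [rq]] := sub p (Cell_refl p) _ (nbhsx_ballx p _ e0).
  rewrite -ball_normE /= => pr; rewrite -rq.
  have pr' j : `|(p - r) ord0 j| <= `|hp_form (H i) p| / s.
    by apply: le_trans (norm_entry_le _ _) (ltW pr).
  have := dot_le_bound (hp_normal (H i)) pr'; rewrite dotBr.
  have -> : dot (hp_normal (H i)) p - dot (hp_normal (H i)) r = hp_form (H i) p - hp_form (H i) r.
    by rewrite !hp_formE /aeval /=; lra.
  move: e0; set x := hp_form _ p; set y := hp_form _ r; set e := _ / s => e0.
  have : e * s = `|x| by rewrite divfK ?gt_eqF.
  have -> : \sum_j `|hp_normal (H i) ord0 j| = s - 1 by rewrite addrC addKr.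
  move=> es le; have {es} le : `|x - y| < `|x| by nra.
  have [x0|x0|x0] := ltrgtP x 0; last by move: f0; rewrite -/x x0 normr0 ltxx.
    move: le; rewrite (ltr0_norm x0) ltr_norml => /andP[? ?].
    by rewrite /sgn -/x -/y !ltr0_sg //; lra.
  move: le; rewrite (gtr0_norm x0) ltr_norml => /andP[? ?].
  by rewrite /sgn -/x -/y !gtr0_sg //; lra.
move=> /nbhs_ballP[e /= e0 eB].
(* With t k at most e, every coordinate of the step t (q - p') is at most e/2. *)
pose k := 2 * (1 + \sum_j `|(q - p') ord0 j|).
have k0 : 0 < k by rewrite mulr_gt0 // ltr_wpDr // sumr_ge0.
pose t := Num.min 1 (e / k).
have t0 : 0 < t by rewrite lt_min ltr01 divr_gt0.
have t1 : t <= 1 by rewrite ge_min lexx.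
have tk : t * k <= e by rewrite -ler_pdivlMr // ge_min lexx orbT.
exists (segpt t p' q); split.
  move=> i; rewrite /sgn hp_formE aeval_segpt -!hp_formE.
  have := le i; rewrite -(pp' i) /sgn.
  set x := hp_form _ p'; set y := hp_form _ q => {}le.
  have [x0|x0|x0] := ltrgtP x 0.
  - have : Num.sg y = -1 by rewrite le ?ltr0_sg // oppr_eq0 oner_eq0.
    move/eqP; rewrite sgr_cp0 => y0; rewrite !ltr0_sg //; nra.
  - have : Num.sg y = 1 by rewrite le ?gtr0_sg // oner_eq0.
    move/eqP; rewrite sgr_cp0 => y0; rewrite !gtr0_sg //; nra.
  - by rewrite x0 mulr0 add0r sgrM gtr0_sg // mul1r.
apply: eB; rewrite -ball_normE /= /segpt opprD addrA subrr sub0r normrN.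
apply: (@le_lt_trans _ _ (e / 2)); last by lra.
apply: norm_row_le => [|j]; first by lra.
have qj : `|(q - p') ord0 j| <= \sum_j `|(q - p') ord0 j|.
  by rewrite (bigD1 j) //= lerDl sumr_ge0.
rewrite mxE normrM (gtr0_norm t0).
move: qj tk; rewrite /k; set X := `|_|; set Y := \sum_j _ => ? ?.
nra.
Qed.

(** When C is a union of faces, its nonempty leaves are exactly the faces inside it. *)
Lemma sum_faces_lsum (f : set pt -> int) C : f set0 = 0 ->
    (forall q, C q -> Cell q `<=` C) ->
  lsum f C arr_forms = \sum_(F <- faces H | `[< F `<=` C >]) f F.
Proof.
move=> f0 sat; rewrite lsum_filter // -[RHS]big_filter; apply: perm_big.
apply: uniq_perm; rewrite ?uniq_leaves ?filter_uniq ?fset_uniq // => G.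
rewrite !mem_filter; apply/andP/andP => [[/set0P[p Gp] GL]|[/asboolP GC /facesP[p GE]]].
  have Cp := leaves_sub GL Gp; rewrite (leavesE GL Gp) sgcell_arr //.
  by split; [apply/asboolP/sat|apply/facesP; exists p].
have Cp : C p by apply: GC; rewrite GE.
split; first by apply/set0P; exists p; rewrite GE.
by rewrite GE -(sgcell_arr sat Cp) mem_leaves.
Qed.

(** The smallest flat containing F; for a face it is the affine span. *)
Definition face_flat (F : set pt) : set pt :=
  flat H [set i | `[< F `<=` hp_set (H i) >]]%SET.

Lemma face_flat_Cell p : face_flat (Cell p) = flat H (zeros p).
Proof.
congr flat; apply/setP => i; rewrite in_zeros inE; apply/asboolP/eqP => [/(_ p)|p0 q qp].
  by move=> /(_ (Cell_refl p)); rewrite /hp_set /sgn /= => ->; rewrite sgr0.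
by apply/eqP; rewrite -sgr_eq0 -[Num.sg _]/(sgn i q) qp p0.
Qed.

Lemma Cell_sub_flat p S : Cell p `<=` flat H S <-> flat H S p.
Proof.
split=> [/(_ p)|/flatP pS q qp]; first exact.
apply/flatP => i iS; apply/eqP; rewrite -sgr_eq0 -[Num.sg _]/(sgn i q) qp.
by rewrite /sgn pS // sgr0.
Qed.

Lemma face_flat_sub p S : face_flat (Cell p) `<=` flat H S <-> flat H S p.
Proof.
rewrite face_flat_Cell; split=> [/(_ p)|/flatP pS q /flatP qp].
  by apply; apply: flat_zeros.
by apply/flatP => i iS; apply: qp; rewrite in_zeros /sgn pS // sgr0.
Qed.

(** The midpoint of q and a point r of [Cell p] lies in [Cell q], so the coordinates of r are at
    most 2M + M. *)
Lemma bnd_closure p q : Cell p `<=` closure (Cell q) -> bnd (Cell q) -> bnd (Cell p).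
Proof.
move=> /closure_CellP le [M qM]; exists (3 * M) => r rp j.
have sr : Cell q (segpt 2^-1 r q).
  move=> i; rewrite /sgn hp_formE aeval_segpt -!hp_formE.
  have := le i; rewrite -(rp i) /sgn.
  set x := hp_form _ r; set y := hp_form _ q => {}le.
  have [x0|x0|x0] := ltrgtP x 0.
  - have : Num.sg y = -1 by rewrite le ?ltr0_sg // oppr_eq0 oner_eq0.
    by move/eqP; rewrite sgr_cp0 => y0; rewrite !ltr0_sg //; lra.
  - have : Num.sg y = 1 by rewrite le ?gtr0_sg // oner_eq0.
    by move/eqP; rewrite sgr_cp0 => y0; rewrite !gtr0_sg //; lra.
  - by rewrite x0 mulr0 add0r sgrM gtr0_sg ?mul1r //; lra.
have := qM _ sr j; have := qM _ (Cell_refl q) j; rewrite !mxE !ler_norml.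
by move=> /andP[? ?] /andP[? ?]; apply/andP; split; lra.
Qed.

Lemma unbounded_facesP F : reflect (exists2 p, F = Cell p & ~ bnd (Cell p))
  (F \in unbounded_faces H).
Proof.
apply: (iffP idP) => [|[p -> nb]].
  rewrite !inE => /andP[/facesP[p ->] /asboolP nb]; exists p => // b.
  by apply: nb; apply/bnd_bounded.
rewrite !inE; apply/andP; split; first by apply/facesP; exists p.
by apply/asboolP => /bnd_bounded.
Qed.

Lemma sum_unbounded_faces (P : pred (set pt)) (f : set pt -> int) :
  \sum_(F <- unbounded_faces H | P F) f F =
  \sum_(F <- faces H | P F && ~~ `[< bnd F >]) f F.
Proof.
rewrite -[LHS]big_filter -[RHS]big_filter; apply: perm_big; apply: uniq_perm.
- by rewrite filter_uniq ?fset_uniq.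
- by rewrite filter_uniq ?fset_uniq.
move=> F; rewrite !mem_filter !inE -andbA; congr (_ && _); rewrite andbC.
by congr (~~ _ && _); apply/asbool_equiv_eq/bnd_bounded.
Qed.

(** * Euler relations for unbounded faces *)

Lemma sgdim_Cell p : sgdim (Cell p) = (-1) ^+ affdim (Cell p).
Proof. by rewrite /sgdim; case: eqP => // E; have := Cell_refl p; rewrite E. Qed.

Lemma sgdim_flat S p : flat H S p -> sgdim (flat H S) = (-1) ^+ affdim (flat H S).
Proof. by move=> Sp; rewrite /sgdim; case: eqP => // E; rewrite E in Sp. Qed.

(** The faces summed over make up the star of p, a relatively open convex set of the dimension of
    the flat. All are unbounded, as their closures contain [Cell p]. *)
Lemma local_euler p S : ~ bnd (Cell p) -> flat H S p ->
  \sum_(G <- unbounded_faces H | `[< Cell p `<=` closure G >] && `[< G `<=` flat H S >])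
    (-1) ^+ affdim G = (-1) ^+ affdim (flat H S) :> int.
Proof.
move=> nb Sp; rewrite sum_unbounded_faces.
have sat q : star S p q -> Cell q `<=` star S p.
  move=> [Sq sq] r rq; split; first by have /Cell_sub_flat := Sq; apply.
  by move=> i p0; rewrite rq sq.
have := sum_faces_lsum (@sgdim0 R n) sat.
rewrite lsum_sgdim; last by exists (dirs S); apply: tame_star.
rewrite (sgdim_tame (tame_star S p)); last by exists p.
rewrite -(affdim_flat Sp) => ->; rewrite big_seq_cond [RHS]big_seq_cond.
apply: eq_big => [G|G /andP[/facesP[q ->] _]]; last by rewrite sgdim_Cell.
case: (boolP (G \in faces H)) => //= /facesP[q ->]; apply/andP/asboolP.
  move=> [/andP[/asboolP/closure_CellP pq /asboolP/Cell_sub_flat Sq] _].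
  exact: sat.
move=> /(_ q (Cell_refl q))[Sq pq]; have cl : Cell p `<=` closure (Cell q) by apply/closure_CellP.
split; last by apply/asboolP => bq; apply/nb/(bnd_closure cl).
by apply/andP; split; apply/asboolP => //; apply/Cell_sub_flat.
Qed.

(** Subtract the bounded faces in the flat from all of them. The flat is a cone with apex p, so the
    bounded ones add up to 1. *)
Lemma unbounded_euler S p : essential H -> flat H S p ->
  \sum_(G <- unbounded_faces H | `[< G `<=` flat H S >]) (-1) ^+ affdim G =
  (-1) ^+ affdim (flat H S) - 1 :> int.
Proof.
move=> Hess Sp; rewrite sum_unbounded_faces.
have sat q : flat H S q -> Cell q `<=` flat H S by move/Cell_sub_flat.
have tS : is_tame (flat H S) by exists (dirs S); apply: tame_flat.
have cone q t : flat H S q -> 0 < t -> flat H S (p + t *: (q - p)).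
  by move=> Sq _; apply: flat_add => //; apply/scalemx_sub/flat_sub.
transitivity (lsum (@sgdim R n) (flat H S) arr_forms - lsum (@bnd_sgdim R n) (flat H S) arr_forms); last first.
  by rewrite (lsum_bnd_sgdim_cone tS (essential_coercive Hess) Sp cone) lsum_sgdim // (sgdim_flat Sp).
rewrite (sum_faces_lsum (@sgdim0 R n) sat) (sum_faces_lsum (@bnd_sgdim0 R n) sat) -sumrB.
rewrite big_mkcondr big_seq_cond [RHS]big_seq_cond; apply: eq_bigr.
move=> G /andP[/facesP[q ->] _]; rewrite /bnd_sgdim sgdim_Cell.
by case: asboolP => _; rewrite ?subrr ?subr0.
Qed.

(** A face of dimension 0 is a point; hence the span of an unbounded face is never removed from the
    lattice. *)
Lemma unbounded_dim_gt0 p : ~ bnd (Cell p) -> (0 < affdim (Cell p))%N.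
Proof.
move=> nb; rewrite lt0n; apply/eqP => d0; apply: nb.
have Ep : Cell p `<=` [set p].
  move=> q pq; have fp := @flat_zeros p.
  have fq : flat H (zeros p) q by have /Cell_sub_flat := fp; apply.
  move: d0; rewrite affdim_Cell (affdim_flat fp) => /eqP; rewrite mxrank_eq0 => /eqP d0.
  by have := flat_sub fp fq; rewrite d0 submx0 subr_eq0 => /eqP.
exists (\sum_j `|p ord0 j|) => q /Ep -> j.
by rewrite (bigD1 j) //= lerDl sumr_ge0.
Qed.

Lemma Cell_le_flat_eq p q : Cell p `<=` closure (Cell q) ->
  face_flat (Cell p) = face_flat (Cell q) -> Cell p = Cell q.
Proof.
move=> /closure_CellP pq; rewrite !face_flat_Cell => E; apply: Cell_eq => i.
have [p0|/pq//] := eqVneq (sgn i p) 0.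
have /flatP/(_ i) : flat H (zeros p) q by rewrite E; apply: flat_zeros.
by rewrite in_zeros p0 eqxx /sgn => ->; rewrite ?sgr0.
Qed.

Lemma Cell_le_flat p q : Cell p `<=` closure (Cell q) ->
  face_flat (Cell p) `<=` face_flat (Cell q).
Proof.
move=> /closure_CellP pq; rewrite !face_flat_Cell => r /flatP rp.
apply/flatP => i; rewrite in_zeros => q0; apply: rp; rewrite in_zeros.
by apply: contraTT q0 => p0; rewrite pq.
Qed.

End Arr.

(** * The posets of unbounded faces and of flats *)

Lemma noncentral_dim_gt0 (R : realType) (n m : nat) (H : 'I_m -> hyperplane R n) :
  noncentral H -> (0 < n)%N.
Proof.
case: n H => // H Hnc; have : (\bigcap_i hp_set (H i)) 0.
  by move=> i _; have := hp_normal_neq0 (H i); rewrite thinmx0 eqxx.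
by rewrite Hnc.
Qed.

Section Posets.
Variables (R : realType) (n m : nat) (H : 'I_m -> hyperplane R n).
Local Notation pt := 'rV[R]_n.

Definition flats : {fset set pt} := [fset X in lattice_ub_elts H | X != set0]%fset.

Lemma flatsP X : reflect (exists S p, [/\ X = flat H S, flat H S p & (0 < affdim X)%N])
  (X \in flats).
Proof.
apply: (iffP idP).
  rewrite !inE => /andP[/andP[/orP[->//|/imfsetP[S]]]].
  rewrite inE => SX -> d0 /[dup] X0 /set0P[p Sp]; exists S, p; split=> //.
  by move: d0; rewrite (negPf X0) lt0n.
move=> [S [p [-> Sp d0]]]; have X0 : flat H S != set0 by apply/set0P; exists p.
rewrite !inE X0 andbT -lt0n d0 orbT andbT; apply/orP; right.
by apply/imfsetP; exists S => //; rewrite inE.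
Qed.

Lemma face_flat_flats F : F \in unbounded_faces H -> face_flat H F \in flats.
Proof.
move=> /unbounded_facesP[p -> nb]; apply/flatsP; rewrite face_flat_Cell.
exists (zeros H p), p; split=> //; first exact: flat_zeros.
by rewrite -affdim_Cell; apply: unbounded_dim_gt0 nb.
Qed.

Definition face_flatJ (F : unbounded_faces H) : flats := [` face_flat_flats (valP F)]%fset.

Definition flat_le : rel flats := fun x y => `[< val y `<=` val x >].
Definition flat_dim (x : flats) := affdim (val x).
Definition face_le : rel (unbounded_faces H) := fun F G => `[< val F `<=` closure (val G) >].

Lemma flat_dim_gt0 x : (0 < flat_dim x)%N.
Proof. by have /flatsP[S [p []]] := valP x. Qed.

Lemma flat_le_refl : reflexive flat_le.
Proof. by move=> x; apply/asboolP. Qed.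

Lemma flat_le_trans : transitive flat_le.
Proof. by move=> y x z /asboolP yx /asboolP zy; apply/asboolP; apply: subset_trans zy yx. Qed.

Lemma flat_le_dim x y : flat_le x y -> x != y -> (flat_dim y < flat_dim x)%N.
Proof.
rewrite /flat_dim -(inj_eq val_inj) eq_sym => /asboolP.
have /flatsP[S [p [-> _ _]]] := valP x; have /flatsP[T [q [-> Tq _]]] := valP y.
exact: affdim_flat_lt Tq.
Qed.

Lemma face_le_refl : reflexive face_le.
Proof. by move=> F; apply/asboolP/subset_closure. Qed.

Lemma face_le_flat F G : face_le F G -> flat_le (face_flatJ G) (face_flatJ F).
Proof.
have /unbounded_facesP[p Fp _] := valP F; have /unbounded_facesP[q Gq _] := valP G.
rewrite /face_le /flat_le /= Fp Gq => /asboolP FG; apply/asboolP.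
exact: Cell_le_flat.
Qed.

Lemma face_le_eq F G : face_le F G -> face_flatJ F = face_flatJ G -> F = G.
Proof.
move=> /asboolP FG zFG; apply/val_inj.
have : face_flat H (val F) = face_flat H (val G) := congr1 val zFG.
move: FG; have /unbounded_facesP[p -> _] := valP F; have /unbounded_facesP[q -> _] := valP G.
exact: Cell_le_flat_eq.
Qed.

Lemma flat_dim_face G : flat_dim (face_flatJ G) = affdim (val G).
Proof.
rewrite /flat_dim /=; have /unbounded_facesP[p -> _] := valP G.
by rewrite face_flat_Cell affdim_Cell.
Qed.

Lemma flat_le_face x G : flat_le x (face_flatJ G) = `[< val G `<=` val x >].
Proof.
rewrite /flat_le -[val (face_flatJ G)]/(face_flat H (val G)).
have /unbounded_facesP[q -> _] := valP G; have /flatsP[S [_ [-> _ _]]] := valP x.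
by apply: asbool_equiv_eq; rewrite face_flat_sub Cell_sub_flat.
Qed.

Lemma face_euler_local F x : flat_le x (face_flatJ F) ->
  \sum_(G | face_le F G && flat_le x (face_flatJ G)) (-1) ^+ flat_dim (face_flatJ G)
  = (-1) ^+ flat_dim x :> int.
Proof.
rewrite flat_le_face => /asboolP.
under eq_bigr do rewrite flat_dim_face.
under eq_bigl do rewrite flat_le_face.
rewrite /face_le /flat_dim; have /unbounded_facesP[p -> nb] := valP F.
have /flatsP[S [_ [-> _ _]]] := valP x => /Cell_sub_flat Sp.
by rewrite -(local_euler nb Sp) big_seq_fsetE.
Qed.

Lemma face_euler_global x : essential H ->
  \sum_(G | flat_le x (face_flatJ G)) (-1) ^+ flat_dim (face_flatJ G)
  = (-1) ^+ flat_dim x - 1 :> int.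
Proof.
move=> Hess.
under eq_bigr do rewrite flat_dim_face.
under eq_bigl do rewrite flat_le_face.
rewrite /flat_dim; have /flatsP[S [p [-> Sp _]]] := valP x.
by rewrite -(unbounded_euler Hess Sp) big_seq_fsetE.
Qed.

Lemma flat_set0 : flat H finset.set0 = [set: pt].
Proof. by apply/seteqP; split=> // p _; apply/flatP => i; rewrite inE. Qed.

Lemma affdim_setT : affdim [set: pt] = n.
Proof.
rewrite -flat_set0 (@affdim_flat _ _ _ _ _ 0); last by rewrite flat_set0.
rewrite /dirs mxrank_ker (_ : \matrix_(_, _) _ = 0) ?mxrank0 ?subn0 //.
by apply/matrixP => i j; rewrite !mxE inE.
Qed.

Lemma setT_flats : (0 < n)%N -> [set: pt] \in flats.
Proof.
move=> n0; apply/flatsP; exists finset.set0, 0; rewrite flat_set0 affdim_setT.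
by split.
Qed.

(** Rank n - (k + 1) means dimension k + 1; the empty set has rank n and is thereby excluded. *)
Lemma sum_lattice_ub (V : nmodType) (x : flats) k (f : set pt -> V) : (k.+1 < n)%N ->
  \sum_(y : rp_elts (lattice_ub H) | @rp_lt (lattice_ub H) (val x) (val y)
      && (@rp_rank (lattice_ub H) (val y) == (n.-1 - k.+1).+1)) f (val y) =
  \sum_(y : flats | strict flat_le x y && (flat_dim y == k.+1)) f (val y).
Proof.
move=> kn.
pose P (X : set pt) := `[< X `<=` val x >] && (val x != X) && (affdim X == k.+1).
transitivity (\sum_(y <- flats | P y) f y); last first.
  by rewrite big_seq_fsetE; apply: eq_bigl => y; rewrite /strict /flat_le /P (inj_eq val_inj).
rewrite -(big_seq_fsetE _ _ (fun y => @rp_lt (lattice_ub H) (val x) y &&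
   (@rp_rank (lattice_ub H) y == (n.-1 - k.+1).+1)) f) /=.
rewrite -[LHS]big_filter -[RHS]big_filter; apply: perm_big; apply: uniq_perm.
- by rewrite filter_uniq ?fset_uniq.
- by rewrite filter_uniq ?fset_uniq.
move=> X; rewrite !mem_filter.
have -> : (X \in flats) = (X \in lattice_ub_elts H) && (X != set0) by rewrite /flats inE.
case: (X \in lattice_ub_elts H); rewrite ?andbF ?andbT //=.
rewrite /P /rp_lt /= [_ && `[< _ >]]andbC -[RHS]andbA; congr (_ && _).
case: (X =P set0) => _; rewrite ?andbF ?andbT; first by apply/eqP; lia.
by apply/eqP/eqP; lia.
Qed.

(** The ranks 1 to n exclude [Bot], of rank 0, and [Top], of rank n + 1. *)
Lemma sum_T_ub (V : nmodType) (P : pred (rp_type (T_ub H))) k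
    (f : rp_type (T_ub H) -> V) : (k < n)%N ->
  \sum_(y : rp_elts (T_ub H) | P (val y) && (rp_rank (val y) == k.+1)) f (val y) =
  \sum_(F : unbounded_faces H | P (Elt (val F)) && (flat_dim (face_flatJ F) == k.+1))
    f (Elt (val F)).
Proof.
move=> kn; under [RHS]eq_bigl do rewrite flat_dim_face.
rewrite -(big_seq_fsetE _ _ (fun y => P y && (rp_rank y == k.+1)) f).
rewrite -(big_seq_fsetE _ _ (fun F => P (Elt F) && (affdim F == k.+1)) (fun F => f (Elt F))) /=.
rewrite -(big_map (fun F : set pt => Elt F) (fun y => P y && (@rp_rank (T_ub H) y == k.+1)) f).
rewrite -[LHS]big_filter -[RHS]big_filter; apply: perm_big; apply: uniq_perm.
- by rewrite filter_uniq ?fset_uniq.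
- by rewrite filter_uniq // map_inj_uniq ?fset_uniq // => F G [].
move=> y; rewrite !mem_filter; apply: andb_id2l => /andP[_ /eqP rk].
rewrite !inE; case: y rk => [|F|] //=; last by lia.
move=> _; apply/imfsetP/mapP => -[G GF ->]; by exists G.
Qed.

End Posets.

Theorem theorem4p10 (R : realType) (n m : nat) (H : 'I_m -> hyperplane R n)
  (Hess : essential H) (Hnc : noncentral H) :
  ab_index (T_ub H) = ab_rev (omega (ab_a * ab_index (lattice_ub H))).
Proof.
have n_gt0 := noncentral_dim_gt0 Hnc.
pose x0 : flats H := [` setT_flats H n_gt0]%fset.
(* The offset n - 1 - k selects the k highest ranks below n, that is, the dimensions k down to 1. *)
pose psi k (x : flats H) : Zab :=
  chain_sum (P := lattice_ub H) ab_e ab_b k (val x) (n.-1 - k) set0.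
pose D k (G : unbounded_faces H) : Zab :=
  chain_sum_rev (P := T_ub H) ab_e ab_b k Bot (Elt (val G)).
pose T k : Zab := chain_sum_rev (P := T_ub H) ab_e ab_b k Bot Top.
have d_x0 : flat_dim x0 = n by exact: (affdim_setT H).
have x0_le x : flat_le x0 x by apply/asboolP.
have psi0 x : psi 0%N x = 1.
  rewrite /psi chain_sum0; have /flatsP[S [p [xE Sp _]]] := valP x.
  suff -> : @rp_lt (lattice_ub H) (val x) set0 by [].
  by apply/andP; split; [apply/set0P; exists p; rewrite xE|apply/asboolP].
have psiS k x : (k.+1 < n)%N -> psi k.+1 x =
    ab_e * psi k x + ab_b * \sum_(y | strict (@flat_le _ _ _ H) x y && (flat_dim y == k.+1)) psi k y.
  move=> kn; rewrite /psi chain_sumS.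
  have iE : (n.-1 - k.+1).+1 = (n.-1 - k)%N by lia.
  rewrite (sum_lattice_ub x (fun y => chain_sum (P := lattice_ub H) ab_e ab_b k y (n.-1 - k.+1).+1 set0) kn).
  by rewrite iE.
have D0 G : D 0%N G = 1 by rewrite /D chain_sum_rev0.
have T0 : T 0%N = 1 by rewrite /T chain_sum_rev0.
have DS k G : (k < n)%N -> D k.+1 G = ab_e * D k G +
    ab_b * \sum_(F | (face_le F G && (F != G)) && (flat_dim (face_flatJ F) == k.+1)) D k F.
  move=> kn; rewrite /D chain_sum_revS; congr (_ + _ * _).
  rewrite (sum_T_ub (fun y => rp_lt y (Elt (val G) : rp_type (T_ub H)))
    (chain_sum_rev (P := T_ub H) ab_e ab_b k Bot) kn).
  by apply: eq_bigl => F; rewrite [face_le F G && _]andbC.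
have TS k : (k < n)%N -> T k.+1 = ab_e * T k +
    ab_b * \sum_(F | flat_dim (face_flatJ F) == k.+1) D k F.
  move=> kn; rewrite /T chain_sum_revS; congr (_ + _ * _).
  exact: (sum_T_ub (fun y => rp_lt y (Top : rp_type (T_ub H)))
    (chain_sum_rev (P := T_ub H) ab_e ab_b k Bot) kn).
have main : T n = omega (ab_a * psi n.-1 x0).
  exact: (chain_sums_omega (@flat_le_refl _ _ _ H) (@flat_le_trans _ _ _ H)
    (@flat_le_dim _ _ _ H) (@flat_dim_gt0 _ _ _ H) (@face_le_refl _ _ _ H)
    (@face_le_flat _ _ _ H) (@face_le_eq _ _ _ H) (@face_euler_local _ _ _ H)
    (fun x => face_euler_global x Hess)
    omega1 omega_a omega_bM omega_aaM omega_abM d_x0 x0_le psi0 psiS D0 DS T0 TS).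
(* Both sides are now reversals; it remains to match the top-down chain sum of the faces with omega
   of the bottom-up one of the flats. *)
rewrite ab_index_chains -ab_rev_chain_sum; congr ab_rev.
rewrite [LHS]main /psi subnn; congr (omega (ab_a * _)).
by rewrite ab_index_chains /rp_N /= eqxx.
Qed.
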